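(* Let $\mathcal R=(\mathbb R,<,+,\dots)$ be an expansion of the ordered additive group of real numbers, $I$ a nonempty bounded open interval, and $f:I\to\mathbb R$ a definable $C^1$ non-affine function. (1) If $f'$ is strictly increasing or strictly decreasing on some open subinterval of $I$, then $\mathcal R$ is of field-type. (2) If $f'$ is not strictly increasing or strictly decreasing on any open subinterval of $I$, then $\mathcal R$ defines an isomorphic copy of $(\mathcal P(\mathbb N),\mathbb N,\in,+,\cdot)$. In particular, if $f$ is $C^2$, then $\mathcal R$ is of field-type.
   Context: ''Definable'' means definable in $\mathcal R$ with parameters. $\mathcal R$ is of field-type if there are a nonempty bounded open interval $J$ and definable $\oplus,\otimes:J^2\to J$ with $(J,<,\oplus,\otimes)$ isomorphic to $(\mathbb R,<,+,\cdot)$. ''Defines an isomorphic copy'' of the two-sorted structure $(\mathcal P(\mathbb N),\mathbb N,\in,+,\cdot)$ ($\mathcal P(\mathbb N)$ the power set of $\mathbb N$) means there are definable sets and definable relations/functions on them forming an isomorphic structure. *)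

(* Defs.v *)
From mathcomp Require Import all_boot all_order all_algebra.
From mathcomp Require Import all_classical all_reals all_analysis.

Set Implicit Arguments.
Unset Strict Implicit.
Unset Printing Implicit Defensive.

Import Order.TTheory GRing.Theory Num.Theory.
Import numFieldNormedType.Exports.

Local Open Scope classical_set_scope.
Local Open Scope ring_scope.

(* The symbols of the language other than <, + and =. *)
Record signature := Signature {
  fsym : Type;
  fsym_arity : fsym -> nat;
  rsym : Type;
  rsym_arity : rsym -> nat }.

Inductive term (L : signature) : Type :=
| Var of nat
| Add of term L & term L
| App (s : fsym L) of ('I_(fsym_arity s) -> term L).

(* Variables are de Bruijn indices: Ex binds index 0. *)
Inductive formula (L : signature) : Type :=
| Eq of term L & term L
| Lt of term L & term L
| Rel (s : rsym L) of ('I_(rsym_arity s) -> term L)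
| Not of formula L
| And of formula L & formula L
| Ex of formula L.

(* An expansion (R, <, +, ...) of the ordered additive group of R: since < and +
   have their usual meaning, only the additional symbols are interpreted. *)
Record expansion (R : realType) := Expansion {
  lang :> signature;
  finterp : forall s : fsym lang, (fsym_arity s).-tuple R -> R;
  rinterp : forall s : rsym lang, (rsym_arity s).-tuple R -> Prop }.

Section Definability.
Variables (R : realType) (M : expansion R).

Fixpoint eval (v : nat -> R) (t : term M) : R :=
  match t with
  | Var k => v k
  | Add t1 t2 => eval v t1 + eval v t2
  | App s ts => finterp [tuple eval v (ts i) | i < fsym_arity s]
  end.

Definition push (x : R) (v : nat -> R) : nat -> R :=
  fun k => if k is j.+1 then v j else x.

Fixpoint holds (v : nat -> R) (phi : formula M) : Prop :=
  match phi with
  | Eq t1 t2 => eval v t1 = eval v t2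
  | Lt t1 t2 => eval v t1 < eval v t2
  | Rel s ts => rinterp [tuple eval v (ts i) | i < rsym_arity s]
  | Not psi => ~ holds v psi
  | And psi1 psi2 => holds v psi1 /\ holds v psi2
  | Ex psi => exists x : R, holds (push x v) psi
  end.

(* Definability with parameters: the variables 0, ..., n - 1 stand for the
   coordinates of x, and variable n + k for the parameter c k (a formula
   mentions only finitely many of them). *)
Definition definable (n : nat) (X : set (n.-tuple R)) : Prop :=
  exists (phi : formula M) (c : nat -> R),
    forall x : n.-tuple R, X x <-> holds (fun k => nth (c (k - n)%N) x k) phi.

(* Definability of the restriction of f to D, via its graph. *)
Definition definable_fun1 (D : set R) (f : R -> R) : Prop :=
  definable [set [tuple x; f x] | x in D].

Definition definable_op1 (D : set R) (op : R -> R -> R) : Prop :=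
  definable [set [tuple x; y; op x y] | x in D & y in D].

Definition definable_op (n : nat) (D : set (n.-tuple R))
    (op : n.-tuple R -> n.-tuple R -> n.-tuple R) : Prop :=
  definable [set [tuple of x ++ y ++ op x y] | x in D & y in D].

Definition definable_rel (m n : nat) (D : set (m.-tuple R))
    (E : set (n.-tuple R)) (r : m.-tuple R -> n.-tuple R -> Prop) : Prop :=
  definable [set z : (m + n).-tuple R | exists x y,
    [/\ D x, E y, r x y & z = [tuple of x ++ y]]].

Definition field_type : Prop :=
  exists (p q : R) (oplus otimes : R -> R -> R),
    let J := `]p, q[%classic in
    [/\ p < q,
        (forall x y, J x -> J y -> J (oplus x y) /\ J (otimes x y)),
        definable_op1 J oplus,
        definable_op1 J otimes
      & exists h : R -> R,
          [/\ set_bij [set: R] J h,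
              (forall x y, (x < y) = (h x < h y)),
              (forall x y, h (x + y) = oplus (h x) (h y))
            & (forall x y, h (x * y) = otimes (h x) (h y))]].

(* The set A carries the copy of P(N) and B the copy of N. *)
Definition defines_copy_PN : Prop :=
  exists (m n : nat) (A : set (m.-tuple R)) (B : set (n.-tuple R))
    (mem : n.-tuple R -> m.-tuple R -> Prop)
    (add mul : n.-tuple R -> n.-tuple R -> n.-tuple R),
    [/\ definable A /\ definable B,
        (forall x y, B x -> B y -> B (add x y) /\ B (mul x y)),
        definable_rel B A mem,
        definable_op B add /\ definable_op B mul
      & exists (h : set nat -> m.-tuple R) (g : nat -> n.-tuple R),
          [/\ set_bij [set: set nat] A h,
              set_bij [set: nat] B g,
              (forall k S, S k <-> mem (g k) (h S)),
              (forall i j, g (i + j)%N = add (g i) (g j))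
            & (forall i j, g (i * j)%N = mul (g i) (g j))]].

End Definability.

Section OnInterval.
Variables (R : realType) (a b : R) (f : R -> R).

Definition affine_on : Prop :=
  exists c d : R, forall x, x \in `]a, b[ -> f x = c * x + d.

Definition C1_on : Prop :=
  (forall x, x \in `]a, b[ -> derivable f x 1) /\
  (forall x, x \in `]a, b[ -> {for x, continuous (derive1 f)}).

Definition strictly_increasing_on : Prop :=
  forall x y, x \in `]a, b[ -> y \in `]a, b[ -> x < y -> f x < f y.

Definition strictly_decreasing_on : Prop :=
  forall x y, x \in `]a, b[ -> y \in `]a, b[ -> x < y -> f y < f x.

End OnInterval.

Definition C2_on (R : realType) (a b : R) (f : R -> R) : Prop :=
  C1_on a b f /\ C1_on a b (derive1 f).

Definition strictly_monotone_somewhere (R : realType) (a b : R) (g : R -> R) :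
    Prop :=
  exists c d : R, [/\ c < d, `]c, d[ `<=` `]a, b[
    & strictly_increasing_on c d g \/ strictly_decreasing_on c d g].

(* Main.v *)
Require Import Defs.
From mathcomp Require Import all_boot all_order all_algebra.
From mathcomp Require Import all_classical all_reals all_analysis.
From mathcomp Require Import ring lra zify.
Import Order.TTheory GRing.Theory Num.Theory.
Import numFieldNormedType.Exports.
Local Open Scope classical_set_scope.
Local Open Scope ring_scope.

(**
The derivative need not be definable, but slopes can be compared definably:
the germs [x |-> f (a + x) - f a] have slope [f' a], sums and compositions of
germs add and multiply slopes, and if [f'] exceeds [f' p] on some [(p, q)],
then a germ has positive slope exactly when it exceeds, to the right of [0],
the germ of slope [f' c - f' p] for some [c] in [(p, q)]. Hence every polynomial
condition on [f' x_1, ..., f' x_n] is definable.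

If [f'] is strictly increasing on [[p, q]], the chart
[a |-> 1 / (f' q - f' a) - 1 / (f' a - f' p)] transports the real field to
[(p, q)], and clearing denominators makes the transported operations polynomial
conditions on slopes.

Otherwise let [X] be the set of records of [f'], the points where [f'] is larger
than at all earlier points of [[p, q]]; [f'] maps [X] increasingly onto an
interval of values. As [f'] is nowhere strictly monotone, the values of the
points of [X] followed by a gap of [X] are dense, and only finitely many gaps
are longer than a given one. This stratifies a dense set of values into finite
stages. A value [c] is a code: at each stage it lies between two neighbouring
points [l < r] of the stage, and the ratio [(c - l) / (r - l)] selects an
element of a sparse definable sequence [d_0 < d_1 < ...] of order type omega.
Sparseness makes all choices independent, so that every subset of N has a code,
and so do the graphs of addition and multiplication, enumerated by
[k |-> (logn 2 k, logn 3 k)].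
*)

Set Implicit Arguments.
Unset Strict Implicit.
Unset Printing Implicit Defensive.

(** * Definable sets of environments *)

Section Renaming.
Variables (R : realType) (M : expansion R).

Fixpoint rename_term (r : nat -> nat) (t : term M) : term M :=
  match t with
  | Var k => Var M (r k)
  | Add t1 t2 => Add (rename_term r t1) (rename_term r t2)
  | App s ts => App (fun i => rename_term r (ts i))
  end.

Definition lift_renaming (r : nat -> nat) : nat -> nat :=
  fun k => if k is j.+1 then (r j).+1 else 0%N.

Fixpoint rename (r : nat -> nat) (phi : formula M) : formula M :=
  match phi with
  | Eq t1 t2 => Eq (rename_term r t1) (rename_term r t2)
  | Lt t1 t2 => Lt (rename_term r t1) (rename_term r t2)
  | Rel s ts => Rel (fun i => rename_term r (ts i))
  | Not psi => Not (rename r psi)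
  | And psi1 psi2 => And (rename r psi1) (rename r psi2)
  | Ex psi => Ex (rename (lift_renaming r) psi)
  end.

Lemma eval_rename r v (t : term M) :
  Defs.eval v (rename_term r t) = Defs.eval (v \o r) t.
Proof.
elim: t => [k|t1 IH1 t2 IH2|s ts IH] //=; first by rewrite IH1 IH2.
by congr finterp; apply: eq_mktuple => i; rewrite IH.
Qed.

Lemma push_lift (x : R) v r : push x v \o lift_renaming r = push x (v \o r).
Proof. by apply: funext => -[|k]. Qed.

Lemma holds_rename r v (phi : formula M) :
  holds v (rename r phi) <-> holds (v \o r) phi.
Proof.
elim: phi r v => [t1 t2|t1 t2|s ts|psi IH|psi1 IH1 psi2 IH2|psi IH] r v /=.
- by rewrite !eval_rename.
- by rewrite !eval_rename.
- suff -> : [tuple Defs.eval v (rename_term r (ts i)) | i < rsym_arity s] =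
            [tuple Defs.eval (v \o r) (ts i) | i < rsym_arity s] by [].
  by apply: eq_mktuple => i; rewrite eval_rename.
- by rewrite IH.
- by rewrite IH1 IH2.
- by split=> -[x Hx]; exists x; move: Hx; rewrite IH push_lift.
Qed.

End Renaming.

Section Definability.
Variables (R : realType) (M : expansion R).

(* Even variables carry the free variables, odd ones the parameters. *)
Definition interleave (v c : nat -> R) : nat -> R :=
  fun k => if odd k then c k./2 else v k./2.

(** Predicates on whole environments rather than on tuples: quantifiers and substitutions then act
    by shifting indices, with no arity to track. *)
Definition dset (P : (nat -> R) -> Prop) : Prop :=
  exists (phi : formula M) (c : nat -> R),
    forall v, P v <-> holds (interleave v c) phi.

Lemma interleave_even v c k : interleave v c k.*2 = v k.
Proof. by rewrite /interleave odd_double doubleK. Qed.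

Lemma interleave_odd v c k : interleave v c k.*2.+1 = c k.
Proof. by rewrite /interleave /= odd_double /= uphalf_double. Qed.

Lemma dset_iff P Q : (forall v, P v <-> Q v) -> dset P -> dset Q.
Proof.
by move=> PQ [phi [c H]]; exists phi, c => v; rewrite -PQ.
Qed.

Lemma dset_not P : dset P -> dset (fun v => ~ P v).
Proof. by move=> [phi [c H]]; exists (Not phi), c => v /=; rewrite H. Qed.

Lemma dset_and P Q : dset P -> dset Q -> dset (fun v => P v /\ Q v).
Proof.
move=> [phi [c H]] [psi [d K]].
(* Parameter [j] of the first formula becomes parameter [2j] of the merged sequence, and parameter
   [j] of the second becomes parameter [2j + 1]. *)
pose left_ k := if odd k then k./2.*2.*2.+1 else k.
pose right_ k := if odd k then k./2.*2.+1.*2.+1 else k.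
exists (And (rename left_ phi) (rename right_ psi)), (interleave c d) => v /=.
rewrite !holds_rename H K.
suff [-> ->] : interleave v (interleave c d) \o left_ = interleave v c /\
   interleave v (interleave c d) \o right_ = interleave v d by [].
split; apply: funext => k /=; rewrite /left_ /right_; case: ifP => ok.
- by rewrite interleave_odd interleave_even /interleave ok.
- by rewrite /interleave ok.
- by rewrite !interleave_odd /interleave ok.
- by rewrite /interleave ok.
Qed.

Lemma dset_ex (Q : R -> (nat -> R) -> Prop) :
  dset (fun v => Q (v 0%N) (fun k => v k.+1)) -> dset (fun v => exists x, Q x v).
Proof.
move=> [phi [c H]].
(* The binder raises every index by one, whereas prepending [x] to [v] moves the even variables by
   two and leaves the parameters; so a positive even index drops by one and an odd one rises by
   one. *)
pose r k := if k is j.+1 then if odd j then j else k.+1 else 0%N.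
exists (Ex (rename r phi)), c => v /=.
suff E x : push x (interleave v c) \o r = interleave (push x v) c.
  by split=> -[x Hx]; exists x; move: Hx; rewrite holds_rename E -H.
apply: funext => -[|[|k]] //=; rewrite /interleave /= !negbK.
by case ok: (odd k); rewrite /= ok.
Qed.

Lemma dset_rename (r : nat -> nat) P :
  dset P -> dset (fun v => P (fun k => v (r k))).
Proof.
move=> [phi [c H]].
exists (rename (fun k => if odd k then k else (r k./2).*2) phi), c => v.
rewrite holds_rename H.
suff -> : interleave v c \o (fun k => if odd k then k else (r k./2).*2) =
  interleave (fun k => v (r k)) c by [].
apply: funext => k /=; case: ifP => ok; last rewrite interleave_even;
  by rewrite /interleave ok.
Qed.

Lemma dset_or P Q : dset P -> dset Q -> dset (fun v => P v \/ Q v).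
Proof.
move=> hP hQ; apply: dset_iff (dset_not (dset_and (dset_not hP) (dset_not hQ))).
by move=> v; split; [move/not_andP => [/contrapT|/contrapT]; tauto|tauto].
Qed.

Lemma dset_imp P Q : dset P -> dset Q -> dset (fun v => P v -> Q v).
Proof.
move=> hP hQ; apply: dset_iff (dset_not (dset_and hP (dset_not hQ))).
by move=> v; split=> [H p|]; [apply: contrapT => q; apply: H|tauto].
Qed.

Lemma dset_equiv P Q : dset P -> dset Q -> dset (fun v => P v <-> Q v).
Proof. by move=> hP hQ; apply: dset_and; apply: dset_imp. Qed.

Lemma dset_all (Q : R -> (nat -> R) -> Prop) :
  dset (fun v => Q (v 0%N) (fun k => v k.+1)) -> dset (fun v => forall x, Q x v).
Proof.
move=> /dset_not hQ.
apply: dset_iff (dset_not (dset_ex (Q := fun x v => ~ Q x v) hQ)) => v.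
split=> [H x|H [x]]; last by apply; exact: H.
by apply: contrapT => nQ; apply: H; exists x.
Qed.

Lemma dset_and3 P1 P2 P3 : dset P1 -> dset P2 -> dset P3 ->
  dset (fun v => [/\ P1 v, P2 v & P3 v]).
Proof.
move=> h1 h2 h3; apply: dset_iff (dset_and (dset_and h1 h2) h3) => v.
by split=> [[[]]|[]].
Qed.

Lemma dset_and4 P1 P2 P3 P4 :
  dset P1 -> dset P2 -> dset P3 -> dset P4 ->
  dset (fun v => [/\ P1 v, P2 v, P3 v & P4 v]).
Proof.
move=> h1 h2 h3 h4; apply: dset_iff (dset_and (dset_and3 h1 h2 h3) h4) => v.
by split=> [[[]]|[]].
Qed.

Lemma dset_and5 P1 P2 P3 P4 P5 :
  dset P1 -> dset P2 -> dset P3 -> dset P4 -> dset P5 ->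
  dset (fun v => [/\ P1 v, P2 v, P3 v, P4 v & P5 v]).
Proof.
move=> h1 h2 h3 h4 h5; apply: dset_iff (dset_and (dset_and4 h1 h2 h3 h4) h5) => v.
by split=> [[[]]|[]].
Qed.

Lemma dset_andb (b1 b2 : (nat -> R) -> bool) :
  dset (fun v => b1 v) -> dset (fun v => b2 v) ->
  dset (fun v => b1 v && b2 v).
Proof.
by move=> h1 h2; apply: dset_iff (dset_and h1 h2) => v; split=> /andP.
Qed.

Definition dfun (F : (nat -> R) -> R) : Prop :=
  dset (fun v => v 0%N = F (fun k => v k.+1)).

Lemma dfun_var i : dfun (fun v => v i).
Proof.
exists (Eq (Var M 0) (Var M i.+1.*2)), (fun=> 0) => v /=.
by rewrite (interleave_even _ _ i.+1).
Qed.

Lemma dfun_const x : dfun (fun=> x).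
Proof. by exists (Eq (Var M 0) (Var M 1)), (fun=> x) => v. Qed.

Lemma dset_subst (P : R -> (nat -> R) -> Prop) F :
  dset (fun v => P (v 0%N) (fun k => v k.+1)) -> dfun F ->
  dset (fun v => P (F v) v).
Proof.
move=> hP hF.
apply: dset_iff (dset_ex (Q := fun x v => x = F v /\ P x v) (dset_and hF hP)).
by move=> v; split=> [[x [-> //]]|H]; exists (F v).
Qed.

Lemma dset_app1 (P : R -> Prop) F :
  dset (fun v => P (v 0%N)) -> dfun F -> dset (fun v => P (F v)).
Proof. by move=> hP hF; apply: (dset_subst (P := fun x _ => P x)) hF. Qed.

Lemma dfun_shift F : dfun F -> dfun (fun v => F (fun k => v k.+1)).
Proof.
by move=> /(dset_rename (fun k => if k is j.+1 then j.+2 else 0%N)).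
Qed.

Lemma dset_app2 (P : R -> R -> Prop) F G :
  dset (fun v => P (v 0%N) (v 1%N)) -> dfun F -> dfun G ->
  dset (fun v => P (F v) (G v)).
Proof.
move=> hP hF hG.
apply: (dset_subst (P := fun x v => P x (G v))) hF.
apply: (dset_subst (P := fun y v => P (v 0%N) y)) (dfun_shift hG).
(* The last value substituted sits at index 0, so the arguments arrive in reverse order. *)
exact: (dset_rename (fun k => if k is 0 then 1 else 0)%N) hP.
Qed.

Lemma dset_app3 (P : R -> R -> R -> Prop) F G H :
  dset (fun v => P (v 0%N) (v 1%N) (v 2%N)) ->
  dfun F -> dfun G -> dfun H -> dset (fun v => P (F v) (G v) (H v)).
Proof.
move=> hP hF hG hH.
apply: (dset_subst (P := fun x v => P x (G v) (H v))) hF.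
apply: (dset_subst (P := fun y v => P (v 0%N) y (H (fun k => v k.+1))))
  (dfun_shift hG).
apply: (dset_subst (P := fun z v => P (v 1%N) (v 0%N) z))
  (dfun_shift (dfun_shift hH)).
exact: (dset_rename (fun k => if k is 0 then 2 else if k is 1 then 1 else 0)%N) hP.
Qed.

Lemma dset_app4 (P : R -> R -> R -> R -> Prop) F G H K :
  dset (fun v => P (v 0%N) (v 1%N) (v 2%N) (v 3%N)) ->
  dfun F -> dfun G -> dfun H -> dfun K ->
  dset (fun v => P (F v) (G v) (H v) (K v)).
Proof.
move=> hP hF hG hH hK.
apply: (dset_subst (P := fun x v => P x (G v) (H v) (K v))) hF.
apply: (dset_subst (P := fun y v => P (v 0%N) y (H (fun k => v k.+1))
  (K (fun k => v k.+1)))) (dfun_shift hG).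
apply: (dset_subst (P := fun z v => P (v 1%N) (v 0%N) z (K (fun k => v k.+2))))
  (dfun_shift (dfun_shift hH)).
apply: (dset_subst (P := fun z v => P (v 2%N) (v 1%N) (v 0%N) z))
  (dfun_shift (dfun_shift (dfun_shift hK))).
exact: (dset_rename (fun k => if k is 0 then 3 else if k is 1 then 2
  else if k is 2 then 1 else 0)%N) hP.
Qed.

Lemma dset_eq F G : dfun F -> dfun G -> dset (fun v => F v = G v).
Proof. by move=> hF hG; apply: (dset_app2 (dfun_var 0) hF hG). Qed.

Lemma dset_lt F G : dfun F -> dfun G -> dset (fun v => F v < G v).
Proof.
move=> hF hG; apply: (dset_app2 (P := fun x y => x < y)) hF hG.
by exists (Lt (Var M 0) (Var M 2)), (fun=> 0) => v.
Qed.

Lemma dset_le F G : dfun F -> dfun G -> dset (fun v => F v <= G v).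
Proof.
move=> hF hG; apply: dset_iff (dset_not (dset_lt hG hF)) => v.
by rewrite leNgt; split=> /negP.
Qed.

Lemma dfun_app1 (f : R -> R) F :
  dset (fun v => v 0%N = f (v 1%N)) -> dfun F -> dfun (fun v => f (F v)).
Proof.
move=> hf hF.
exact: (dset_app2 (P := fun x y => x = f y) hf (dfun_var 0) (dfun_shift hF)).
Qed.

Lemma dfun_subst (f : R -> (nat -> R) -> R) F :
  dfun (fun v => f (v 0%N) (fun k => v k.+1)) -> dfun F ->
  dfun (fun v => f (F v) v).
Proof.
move=> hf hF; rewrite /dfun.
apply: (dset_subst (P := fun x v => v 0%N = f x (fun k => v k.+1)))
  (dfun_shift hF).
exact: (dset_rename (fun k => if k is j.+2 then k
                              else if k is 0 then 1 else 0)%N) hf.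
Qed.

Lemma dfun_add F G : dfun F -> dfun G -> dfun (fun v => F v + G v).
Proof.
move=> hF hG.
apply: (dfun_subst (f := fun x v => x + G v)) hF.
apply: (dfun_subst (f := fun y v => v 0%N + y)) (dfun_shift hG).
exists (Eq (Var M 0) (Add (Var M 4) (Var M 2))), (fun=> 0) => v //=.
Qed.

Lemma dfun_opp F : dfun F -> dfun (fun v => - F v).
Proof.
apply: dfun_app1.
apply: dset_iff (dset_eq (dfun_add (dfun_var 0) (dfun_var 1)) (dfun_const 0)).
by move=> v; split=> [/eqP|->]; rewrite ?addNr // addr_eq0 => /eqP.
Qed.

Lemma dfun_sub F G : dfun F -> dfun G -> dfun (fun v => F v - G v).
Proof. by move=> hF hG; apply: dfun_add => //; apply: dfun_opp. Qed.

Lemma dfun_ite P F G : dset P -> dfun F -> dfun G ->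
  dfun (fun v => if `[< P v >] then F v else G v).
Proof.
move=> /(dset_rename S) hP hF hG.
apply: dset_iff (dset_or (dset_and hP hF) (dset_and (dset_not hP) hG)) => v.
by case: asboolP; tauto.
Qed.

(** Bridge to the notion of the theorem, in which the parameters follow the [n] coordinates of the
    tuple. *)
Lemma definable_dset n (X : set (n.-tuple R)) :
  definable M X <-> dset (fun v => X [tuple v i | i < n]).
Proof.
split=> [[phi [c H]]|[phi [c H]]].
  exists (rename (fun k => if (k < n)%N then k.*2 else (k - n)%N.*2.+1) phi), c.
  move=> v; rewrite H holds_rename.
  suff -> : (fun k => nth (c (k - n)%N) [tuple v i | i < n] k) =
    interleave v c \o (fun k => if (k < n)%N then k.*2 else (k - n)%N.*2.+1)
    by [].
  apply: funext => k; rewrite [RHS]/comp; case: ltnP => kn.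
    have := tnth_nth (c (k - n)%N) [tuple v i | i < n] (Ordinal kn).
    by rewrite interleave_even tnth_mktuple => <-.
  by rewrite interleave_odd nth_default // size_tuple.
(* Variables beyond the [n] coordinates all read parameter 0, set to 0 in agreement with the default
   of [nth 0 x]; the genuine parameters move up by one. *)
pose r k := if odd k then (n + k./2.+1)%N else if (k./2 < n)%N then k./2 else n.
exists (rename r phi), (fun k => if k is j.+1 then c j else 0) => x.
rewrite holds_rename.
have {1}-> : x = [tuple nth 0 x i | i < n].
  by apply: eq_from_tnth => i; rewrite tnth_mktuple (tnth_nth 0).
rewrite (H (nth 0 x)).
suff -> : interleave (nth 0 x) c =
  (fun k => nth (if (k - n)%N is j.+1 then c j else 0) x k) \o r by [].
apply: funext => k; rewrite /interleave /r /=; case: ifP => _.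
  by rewrite nth_default ?size_tuple ?leq_addr // addKn.
case: ltnP => kn; first by apply: set_nth_default; rewrite size_tuple.
by rewrite [RHS]nth_default ?size_tuple // subnn nth_default ?size_tuple.
Qed.

End Definability.

Ltac dset_step :=
  lazymatch goal with
  | |- dfun _ (fun v => v _) => exact: dfun_var
  | |- dfun _ (fun v => _ - _) => apply: dfun_sub
  | |- dfun _ (fun v => _ + _) => apply: dfun_add
  | |- dfun _ (fun v => - _) => apply: dfun_opp
  | |- dfun _ (fun v => _) => first [exact: dfun_const | assumption]
  | |- dset _ (fun v => _ /\ _) => apply: dset_and
  | |- dset _ (fun v => [/\ _, _ & _]) => apply: dset_and3
  | |- dset _ (fun v => [/\ _, _, _ & _]) => apply: dset_and4
  | |- dset _ (fun v => [/\ _, _, _, _ & _]) => apply: dset_and5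
  | |- dset _ (fun v => is_true (_ && _)) => apply: dset_andb
  | |- dset _ (fun v => _ \/ _) => apply: dset_or
  | |- dset _ (fun v => _ <-> _) => apply: dset_equiv
  | |- dset _ (fun v => ~ _) => apply: dset_not
  | |- dset _ (fun v => exists x, _) => apply: dset_ex
  | |- dset _ (fun v => is_true (_ < _)) => apply: dset_lt
  | |- dset _ (fun v => is_true (_ <= _)) => apply: dset_le
  | |- dset _ (fun v => _ = _) => apply: dset_eq
  | |- dset _ (fun v => _ -> _) => apply: dset_imp
  | |- dset _ (fun v => forall x, _) => apply: dset_all
  end.

(** * Coding sequences in a dense set with finite stages *)

Section FiniteLists.
Variable R : realType.

Lemma seq_least (P : R -> Prop) (s : seq R) :
  (exists2 x, x \in s & P x) ->
  exists x, [/\ x \in s, P x & forall y, y \in s -> P y -> x <= y].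
Proof.
elim: s => [[]//|a s IH] [x xs Px].
have [[y ys Py]|nP] := pselect (exists2 y, y \in s & P y); last first.
  have xa : x = a.
    by move: xs; rewrite in_cons => /orP[/eqP //|xs]; case: nP; exists x.
  subst x; exists a; split=> // y; rewrite in_cons => /orP[/eqP ->//|ys Py].
  by case: nP; exists y.
have [m [ms Pm mle]] := IH (ex_intro2 _ _ y ys Py).
have [[Pa am]|nam] := pselect (P a /\ a <= m).
  exists a; split=> //; first by rewrite in_cons eqxx.
  move=> z; rewrite in_cons => /orP[/eqP -> //|zs Pz].
  exact: le_trans am (mle _ zs Pz).
exists m; split=> //; first by rewrite in_cons ms orbT.
move=> z; rewrite in_cons => /orP[/eqP -> Pa|]; last exact: mle.
by rewrite leNgt; apply/negP => /ltW am; apply: nam.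
Qed.

Lemma seq_free_right (s : seq R) (x y : R) : x < y ->
  exists r, [/\ x < r, r <= y & forall z, z \in s -> ~ x < z < r].
Proof.
elim: s => [|a s IH] xy; first by exists y; split.
have [r [xr ry free]] := IH xy.
have [/andP[xa ar]|nar] := boolP (x < a < r).
  exists a; split=> //; first by rewrite (le_trans (ltW ar)).
  move=> z; rewrite in_cons => /orP[/eqP ->|zs /andP[xz za]].
    by rewrite ltxx andbF.
  by apply: (free _ zs); rewrite xz (lt_trans za).
exists r; split=> // z; rewrite in_cons => /orP[/eqP ->|/free //].
by move=> xar; rewrite xar in nar.
Qed.

End FiniteLists.

(** * Nested intervals *)

Section Increasing.
Variables (R : realType) (l r : nat -> R).
Hypotheses (l_inc : forall k, l k < l k.+1) (r_dec : forall k, r k.+1 < r k).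
Hypothesis (l_lt_r : forall k, l k < r k).

Lemma nested_mono i j : (i < j)%N -> l i < l j.
Proof.
elim: j => // j IH; rewrite ltnS leq_eqVlt => /orP[/eqP -> //|/IH h].
exact: lt_trans h _.
Qed.

Lemma nested_anti i j : (i <= j)%N -> r j <= r i.
Proof.
elim: j => [|j IH]; first by rewrite leqn0 => /eqP ->.
rewrite leq_eqVlt => /orP[/eqP -> //|]; rewrite ltnS => /IH.
exact/le_trans/ltW.
Qed.

(** The point is the supremum of the [l k]; the third clause later shows that the spine exhausts
    everything below its limit. *)
Lemma nested_limit : exists c, [/\ forall k, l k < c, forall k, c < r k
  & forall x, x < c -> exists k, x < l k].
Proof.
have lr i j : l i < r j.
  case: (leqP i j) => [|/ltnW] ij; last exact: lt_le_trans (nested_anti ij).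
  move: ij; rewrite leq_eqVlt => /orP[/eqP -> //|ij].
  exact: lt_trans (nested_mono ij) _.
have hs : has_sup (range l).
  split; first by exists (l 0%N), 0%N.
  by exists (r 0%N) => _ [k _ <-]; apply/ltW.
exists (sup (range l)); split=> k.
- apply: lt_le_trans (l_inc k) _; apply: (sup_upper_bound hs).
  by exists k.+1.
- apply: le_lt_trans (r_dec k); apply: sup_le_ub; first by case: hs.
  by move=> _ [i _ <-]; apply/ltW.
- by move=> /(sup_gt hs.1) [_ [i _ <-]] ki; exists i.
Qed.

End Increasing.

(** * Stages and the spine, a definable sequence of order type omega *)

Section Coding.
Variables (R : realType) (E : R -> Prop) (le : R -> R -> Prop) (gam : R).
Hypotheses (gam0 : 0 < gam) (gam1 : gam <= 1).
Hypothesis E_sub : forall e, E e -> 0 < e < gam.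
Hypothesis E_dense : forall u w : R, 0 <= u -> u < w -> w <= gam ->
  exists2 e, E e & u < e < w.
Hypothesis le_tot : forall x y, E x -> E y -> le x y \/ le y x.
Hypothesis le_tr : forall x y z, le x y -> le y z -> le x z.
Hypothesis le_fin : forall e, E e ->
  exists s : seq R, forall z, E z -> le z e -> z \in s.

Lemma stage_refl x : E x -> le x x.
Proof. by move=> Ex; case: (le_tot Ex Ex). Qed.

(** [le z e] reads: [z] is present at the stage of [e]. By [le_fin] a stage is finite, so it leaves
    room to the right of [x]. *)
Lemma stage_free_right e x y : E e -> x < y ->
  exists r, [/\ x < r, r <= y & forall z, E z -> x < z < r -> ~ le z e].
Proof.
move=> /le_fin [s hs] xy; have [r [xr ry free]] := seq_free_right s xy.
by exists r; split=> // z Ez xzr /(hs _ Ez) /free.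
Qed.

(** The conditions persist at later stages and are finitely many, so the latest of their stages
    serves them all. *)
Lemma stage_bound_seq (A : eqType) (s : seq A) (Q : A -> R -> Prop) :
  (forall a e e', E e -> E e' -> le e e' -> Q a e -> Q a e') ->
  (exists e, E e) ->
  (forall a, a \in s -> exists2 e, E e & Q a e) ->
  exists2 e, E e & forall a, a \in s -> Q a e.
Proof.
move=> Qmono [e0 Ee0]; elim: s => [_|a s IH hs]; first by exists e0.
have [e Ee he] := IH (fun b bs => hs b (mem_behead (s := a :: s) bs)).
have [e' Ee' he'] := hs a (mem_head _ _).
case: (le_tot Ee Ee') => ee.
  exists e' => // b; rewrite in_cons => /orP[/eqP -> //|/he].
  exact: Qmono ee.
exists e => // b; rewrite in_cons => /orP[/eqP ->|/he //].
exact: Qmono ee he'.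
Qed.

(* [d'] is so late a stage that two points of it fall in the image of every
   [(u, w)] under the affine map from [(0, 1)] to [(l, r)]. *)
Definition rich (d d' : R) : Prop := forall l r u w,
  E l -> le l d -> E r -> le r d -> E u -> le u d -> (E w /\ le w d) \/ w = 1 ->
  l < r -> u < w -> exists t1 t2, [/\ E t1 /\ le t1 d', E t2 /\ le t2 d',
    l + u * (r - l) < t1, t1 < t2 & t2 < l + w * (r - l)].

Lemma rich_mono d e e' : le e e' -> rich d e -> rich d e'.
Proof.
move=> ee' H l r u w El ld Er rd Eu ud hw lr uw.
have [t1 [t2 [[Et1 h1] [Et2 h2] lt1 t12 t2r]]] :=
  H l r u w El ld Er rd Eu ud hw lr uw.
by exists t1, t2; split=> //; split=> //; apply: le_tr ee'.
Qed.

(** The stage of [d] is finite, so only finitely many quadruples [(l, r, u, w)] occur. Density meets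
    the demand of each at some stage; [gam <= 1] gives [w <= 1], which keeps the target interval
    within reach of [E_dense]. *)
Lemma rich_exists d : E d -> exists2 e, E e & rich d e.
Proof.
move=> Ed; have [s hs] := le_fin Ed.
have [s1 hs1] : exists s1 : seq R, forall w, (E w /\ le w d) \/ w = 1 -> w \in s1.
  exists (1 :: s) => w; rewrite in_cons => -[[Ew wd]|->]; last by rewrite eqxx.
  by rewrite hs ?orbT.
pose s4 := [seq (a, b) | a <- [seq (x, y) | x <- s, y <- s],
                         b <- [seq (x, y) | x <- s, y <- s1]].
pose Q (a : R * R * (R * R)) (e : R) := forall l r u w, a = ((l, r), (u, w)) ->
  E l -> E r -> E u -> E w \/ w = 1 -> l < r -> u < w ->
  exists t1 t2, [/\ E t1 /\ le t1 e, E t2 /\ le t2 e,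
    l + u * (r - l) < t1, t1 < t2 & t2 < l + w * (r - l)].
have [|||e Ee he] := @stage_bound_seq _ s4 Q.
- move=> a e e' Ee Ee' ee' H l r u w aE El Er Eu hw lr uw.
  have [t1 [t2 [[Et1 h1] [Et2 h2] lt1 t12 t2r]]] := H l r u w aE El Er Eu hw lr uw.
  by exists t1, t2; split=> //; split=> //; apply: le_tr ee'.
- by exists d.
- move=> [[l r] [u w]] _.
  have [[El Er Eu hw [lr uw]]|nh] :=
    pselect [/\ E l, E r, E u, E w \/ w = 1 & l < r /\ u < w]; last first.
    exists d => // l' r' u' w' [<- <- <- <-] ? ? ? ? ? ?.
    by exfalso; apply: nh.
  have /andP[l0 lg] := E_sub El; have /andP[r0 rg] := E_sub Er.
  have /andP[u0 ug] := E_sub Eu.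
  have w1 : w <= 1 by case: hw => [/E_sub /andP[_ /ltW wg]|-> //]; apply: le_trans gam1.
  have [||| t1 Et1 /andP[a1 b1]] := @E_dense (l + u * (r - l)) (l + w * (r - l)).
  + nra.
  + nra.
  + nra.
  have [||| t2 Et2 /andP[a2 b2]] := @E_dense t1 (l + w * (r - l)).
  + by have /andP[/ltW] := E_sub Et1.
  + by [].
  + nra.
  case: (le_tot Et1 Et2) => t12; [exists t2 => //|exists t1 => //];
   move=> l' r' u' w' [<- <- <- <-] _ _ _ _ _ _; exists t1, t2;
   by split=> //; split=> //; apply: stage_refl.
exists e => // l r u w El ld Er rd Eu ud hw lr uw.
apply: (he ((l, r), (u, w))) => //; last by case: hw => [[]|]; tauto.
apply: (allpairs_f pair); first by apply: (allpairs_f pair); apply: hs.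
by apply: (allpairs_f pair); [apply: hs|apply: hs1].
Qed.

(** A state is a spine point with a right bound for all later ones. The window between them avoids
    the stage of the point, which forces every later spine point to a later stage. *)
Definition spine_inv (st : R * R) := [/\ E st.1, st.1 < st.2, st.2 <= gam
  & forall z, E z -> st.1 < z < st.2 -> ~ le z st.1].

(** The last clause is what lets the spine be recovered from its limit: a stray point between two
    spine points comes later than the right one. *)
Definition spine_step (st st' : R * R) :=
  [/\ st.1 < st'.1, st'.2 < st.2, rich st.1 st'.1
    & forall z, E z -> st.1 < z < st'.1 -> ~ le z st'.1].

(** Take a stage [e] rich for [d], shrink the window to avoid that stage, and let [d'] be the
    leftmost point of the window present at the stage of some [b] in it. Being absent from the stage
    of [e], [d'] is later, so richness carries over; being leftmost, it satisfies the last clause of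
    [spine_step]. *)
Lemma spine_step_exists st : spine_inv st ->
  exists2 st', spine_inv st' & spine_step st st'.
Proof.
case: st => d r [/= Ed dr rg free].
have [e Ee de] := rich_exists Ed.
have [r' [dr' r'r free']] := stage_free_right Ee dr.
have /andP[d0 dg] := E_sub Ed.
have [|||b Eb /andP[db br]] := @E_dense d r'; rewrite ?(ltW d0) ?(le_trans r'r) //.
have [s hs] := le_fin Eb.
have [|d' [_ [Ed' d'b /andP[dd' d'r]] d'min]] :=
  @seq_least _ (fun z => [/\ E z, le z b & d < z < r']) s.
  by exists b; [apply: hs => //; apply: stage_refl|split=> //; [apply: stage_refl|rewrite db]].
have [q [d'q qr free'']] := stage_free_right Ed' (d'r : d' < r').
(* The midpoint makes the right bounds strictly decreasing. *)
pose r'' := (d' + q) / 2.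
have h1 : d' < r'' by rewrite /r''; lra.
have h2 : r'' < q by rewrite /r''; lra.
exists (d', r''); split=> //=.
- lra.
- by move=> z Ez /andP[z1 z2]; apply: free'' => //; rewrite z1 (lt_trans z2).
- lra.
- have ned : ~ le d' e by apply: free' => //; rewrite dd'.
  by case: (le_tot Ee Ed') => // h; apply: rich_mono de.
- move=> z Ez /andP[dz zd'] zle.
  have := d'min z (hs _ Ez (le_tr zle d'b)); rewrite leNgt zd'.
  by move=> h; suff: false by []; apply: h; split=> //; [exact: le_tr d'b|lra].
Qed.

(** The limit [cs] of the spine lies in every window, so nothing at the stage of [d k] separates
    [d k] from [cs]. Conversely, a point of [E] strictly between [d n] and [d n.+1] comes after
    [d n.+1], which then separates it from [cs]. Hence the range of [d] is definable from [d 0] and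
    [cs]. *)
Lemma spine_exists : exists (d : nat -> R) (cs : R),
  [/\ forall k, E (d k), forall i j, (i < j)%N -> d i < d j,
      forall i j, le (d i) (d j) <-> (i <= j)%N,
      forall k, rich (d k) (d k.+1)
    & [/\ 0 < cs < gam, exists l r, [/\ E l, E r, l < r, le l (d 0%N) & le r (d 0%N)]
    & forall e, (exists k, e = d k) <->
        [/\ E e, d 0%N <= e, e < cs
          & forall z, E z -> e < z < cs -> ~ le z e]]].
Proof.
have [||| l El /andP[l0 lg]] := @E_dense 0 gam => //.
have [||| r Er /andP[lr rg]] := @E_dense l gam => //; first exact: ltW.
(* Starting at the later of [l] and [r] puts two points at the first stage, from which codes
   begin. *)
have [d0 [Ed0 ld0 rd0]] : exists d0, [/\ E d0, le l d0 & le r d0].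
  case: (le_tot El Er) => h; [exists r|exists l]; split=> //; exact: stage_refl.
have /andP[d00 d0g] := E_sub Ed0.
have [r0 [d0r r0g free0]] := stage_free_right Ed0 d0g.
have /choice [nxt hnxt] : forall st, exists st', spine_inv st ->
    spine_inv st' /\ spine_step st st'.
  move=> st; have [/spine_step_exists [st' ? ?]|] := pselect (spine_inv st).
    by exists st'.
  by exists st.
pose st k := iter k nxt (d0, r0).
have inv k : spine_inv (st k).
  by elim: k => [|k IH] //=; have [] := hnxt _ IH.
have step k : spine_step (st k) (st k.+1) by have [] := hnxt _ (inv k).
pose d k := (st k).1; pose r' k := (st k).2.
have dinc k : d k < d k.+1 by have [] := step k.
have rdec k : r' k.+1 < r' k by have [] := step k.
have dr k : d k < r' k by have [] := inv k.
have Ed k : E (d k) by have [] := inv k.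
have dmono := nested_mono dinc.
have ranti := nested_anti rdec.
have [cs [dcs csr csup]] := nested_limit dinc rdec dr.
have nle i j : (i < j)%N -> ~ le (d j) (d i).
  move=> ij; have [_ _ _ free] := inv i; apply: free => //.
  by rewrite (dmono _ _ ij) (lt_trans (dcs j)) //= csr.
exists d, cs; split=> //.
- move=> i j; split=> [h|ij].
    by rewrite leqNgt; apply/negP => /nle.
  move: ij; rewrite leq_eqVlt => /orP[/eqP ->|/nle]; first exact: stage_refl.
  by case: (le_tot (Ed i) (Ed j)).
- by move=> k; have [] := step k.
split.
- have /andP[h _] := E_sub (Ed 0%N).
  rewrite (lt_trans h (dcs _)) /=; apply: lt_le_trans (csr 0%N) _.
  by have [] := inv 0%N.
- by exists l, r.
move=> e; split=> [[k ->]|[Ee de ecs efree]].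
  split=> //.
    by case: k => // k; apply/ltW/dmono.
  move=> z Ez /andP[z1 z2]; have [_ _ _ free] := inv k; apply: free => //.
  by apply/andP; split=> //; apply: lt_trans (csr k).
have [n en nmin] : exists2 n, e < d n & forall m, e < d m -> (n <= m)%N.
  have [m em] := csup _ ecs.
  by have [n en nmin] := ex_minnP (ex_intro (fun m => e < d m) m em); exists n.
case: n en nmin => [|n] en nmin; first by move: en; rewrite ltNge de.
have : d n <= e by rewrite leNgt; apply/negP => /nmin; rewrite ltnn.
rewrite le_eqVlt => /orP[/eqP <-|dne]; first by exists n.
have [_ _ _ free] := step n.
exfalso; apply: (free e) => //; first by rewrite dne.
case: (le_tot Ee (Ed n.+1)) => // h.
by exfalso; apply: (efree _ (Ed n.+1)) h; rewrite en dcs.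
Qed.

End Coding.

(** * Codes for sequences, sets and operations *)

Section Codes.
Variables (R : realType) (E : R -> Prop) (le : R -> R -> Prop) (gam : R).
Hypothesis gam1 : gam <= 1.
Hypothesis E_sub : forall e, E e -> 0 < e < gam.
Hypothesis le_fin : forall e, E e ->
  exists s : seq R, forall z, E z -> le z e -> z \in s.
Variables (N : R -> Prop) (d : nat -> R).
Hypothesis d_E : forall k, E (d k).
Hypothesis d_mono : forall i j, (i < j)%N -> d i < d j.
Hypothesis d_le : forall i j, le (d i) (d j) <-> (i <= j)%N.
Hypothesis d_rich : forall k, rich E le (d k) (d k.+1).
Hypothesis d_base :
  exists l r, [/\ E l, E r, l < r, le l (d 0%N) & le r (d 0%N)].
Hypothesis N_spine : forall e, N e <-> exists k, e = d k.

Definition piece (x l r : R) : Prop := [/\ E l /\ le l x, E r /\ le r x, l < r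
  & forall z, E z -> l < z < r -> ~ le z x].

(** [y] is the largest spine point at stage [x] not exceeding [(c - l) / (r - l)]. The division is
    cleared so that only polynomial conditions on values occur. *)
Definition decodes (c x y : R) : Prop := exists l r, [/\ piece x l r, l < c < r,
  N y /\ le y x, y * (r - l) <= c - l
  & forall y', N y' -> le y' x -> y' * (r - l) <= c - l -> y' <= y].

Lemma spine_inj i j : d i = d j -> i = j.
Proof.
move=> eq_d; case: (ltngtP i j) => // /d_mono; by rewrite eq_d ltxx.
Qed.

Lemma spine_ltE i j : (d i < d j) = (i < j)%N.
Proof.
case: (ltngtP i j) => [/d_mono //|/d_mono ji|->]; last by rewrite ltxx.
by apply/negbTE; rewrite -leNgt ltW.
Qed.

Lemma decodes_sub c x y : decodes c x y -> 0 < c < gam.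
Proof.
move=> [l [r [[[/E_sub /andP[l0 _] _] [/E_sub /andP[_ rg] _] _ _] /andP[lc cr]]]].
by rewrite (lt_trans l0 lc) (lt_trans cr rg).
Qed.

Lemma piece_unique c x l r l' r' : piece x l r -> piece x l' r' ->
  l < c < r -> l' < c < r' -> l = l' /\ r = r'.
Proof.
move=> [[El lx] [Er rx] lr free] [[El' lx'] [Er' rx'] lr' free'].
move=> /andP[lc cr] /andP[l'c cr']; split.
  case: (ltgtP l l') => // h; exfalso.
    by apply: (free l') lx' => //; rewrite h (lt_trans l'c).
  by apply: (free' l) lx => //; rewrite h (lt_trans lc).
case: (ltgtP r r') => // h; exfalso.
  by apply: (free' r) rx => //; rewrite h (lt_trans l'c).
by apply: (free r') rx' => //; rewrite h (lt_trans lc).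
Qed.

Lemma decodes_fun c x y y' : decodes c x y -> decodes c x y' -> y = y'.
Proof.
move=> [l [r [p lcr [Ny yx] yc ymax]]] [l' [r' [p' lcr' [Ny' yx'] yc' ymax']]].
have [el er] := piece_unique p p' lcr lcr'; subst l' r'.
by apply/eqP; rewrite eq_le ymax' // ymax.
Qed.

Lemma piece_exists k t1 t2 : E t1 -> le t1 (d k) -> E t2 -> le t2 (d k) ->
  t1 < t2 -> exists2 r, piece (d k) t1 r & r <= t2.
Proof.
move=> Et1 l1 Et2 l2 t12; have [s hs] := le_fin (d_E k).
have [|r [_ [Er rd /andP[tr rt]] rmin]] :=
  @seq_least _ (fun z => [/\ E z, le z (d k) & t1 < z <= t2]) s.
  by exists t2; [apply: hs|split=> //; rewrite t12 lexx].
exists r => //; split=> // z Ez /andP[tz zr] zd.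
suff : r <= z by rewrite leNgt zr.
apply: rmin; first exact: hs.
by split=> //; rewrite tz (le_trans (ltW zr)).
Qed.

(** Richness puts a piece of stage [k + 1] inside the part of the current piece where the ratio
    selects [d (s k)]; the nested pieces have a common point. The bound [s k <= k] says that
    [d (s k)] is present at stage [k]. *)
Lemma code_exists (s : nat -> nat) : (forall k, s k <= k)%N ->
  exists c, forall k, decodes c (d k) (d (s k)).
Proof.
move=> sk.
have d0 k : 0 < d k by have /andP[] := E_sub (d_E k).
have d1 k : d k < 1 by have /andP[_ /lt_le_trans] := E_sub (d_E k); apply.
(* Upper end of the ratios selecting [d (s k)]: the next spine point if it is present at stage [k],
   and 1 otherwise. *)
pose top k := if (s k < k)%N then d (s k).+1 else 1.
have top1 k : top k <= 1 by rewrite /top; case: ifP => // _; apply/ltW.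
have step k l r : piece (d k) l r -> exists l' r', [/\ piece (d k.+1) l' r',
    l + d (s k) * (r - l) < l' & r' < l + top k * (r - l)].
  move=> [[El ld] [Er rd] lr free].
  have [||||t1 [t2 [[Et1 l1] [Et2 l2] lt1 t12 t2r]]] :=
    d_rich (k := k) (l := l) (r := r) (u := d (s k)) (w := top k) El ld Er rd (d_E _).
  - exact/d_le.
  - by rewrite /top; case: ifP => sk'; [left; split=> //; apply/d_le|right].
  - by [].
  - by rewrite /top; case: ifP => sk'; [apply: d_mono|].
  have [r' p r't] := piece_exists Et1 l1 Et2 l2 t12.
  by exists t1, r'; split=> //; apply: le_lt_trans t2r.
have /choice [nxt hnxt] : forall a : nat * (R * R), exists b : R * R,
    piece (d a.1) a.2.1 a.2.2 -> [/\ piece (d a.1.+1) b.1 b.2,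
    a.2.1 + d (s a.1) * (a.2.2 - a.2.1) < b.1
    & b.2 < a.2.1 + top a.1 * (a.2.2 - a.2.1)].
  move=> [k [l r]] /=; have [/step [l' [r' H]]|np] := pselect (piece (d k) l r).
    by exists (l', r').
  by exists (l, r).
have [l0 [t [El0 Et l0t ll0 lt]]] := d_base.
have [r0 p0 _] := piece_exists El0 ll0 Et lt l0t.
pose fix st k := if k is j.+1 then nxt (j, st j) else (l0, r0).
have pst k : piece (d k) (st k).1 (st k).2.
  by elim: k => [//|k IH] /=; have [] := hnxt (k, st k) IH.
have stl k : (st k).1 + d (s k) * ((st k).2 - (st k).1) < (st k.+1).1.
  by have [] := hnxt (k, st k) (pst k).
have str k : (st k.+1).2 < (st k).1 + top k * ((st k).2 - (st k).1).
  by have [] := hnxt (k, st k) (pst k).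
have lr k : (st k).1 < (st k).2 by have [] := pst k.
have linc k : (st k).1 < (st k.+1).1.
  apply: le_lt_trans (stl k); rewrite lerDl.
  by apply: mulr_ge0; [apply/ltW|rewrite subr_ge0 ltW].
have rdec k : (st k.+1).2 < (st k).2.
  apply: lt_le_trans (str k) _.
  have : top k * ((st k).2 - (st k).1) <= 1 * ((st k).2 - (st k).1).
    by apply: ler_wpM2r => //; rewrite subr_ge0 ltW.
  by rewrite mul1r; lra.
have [c [lc cr _]] := nested_limit linc rdec lr.
exists c => k; exists (st k).1, (st k).2; split=> //.
- by rewrite lc cr.
- by split; [apply/N_spine; exists (s k)|apply/d_le].
- by have := stl k; have := lc k.+1; lra.
move=> y' /N_spine [i ->] /d_le ik yc; rewrite leNgt spine_ltE; apply/negP => si.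
have : d i * ((st k).2 - (st k).1) < top k * ((st k).2 - (st k).1).
  by have := str k; have := cr k.+1; lra.
rewrite ltr_pM2r ?subr_gt0 // /top (leq_trans si ik) spine_ltE ltnS.
by rewrite leqNgt si.
Qed.

(** The infimum of the codes is a code: codes close above it lie in the same piece, and the
    condition [y * (r - l) <= c - l] passes to the limit. *)
Lemma least_code (t : nat -> nat) :
  (exists c, forall k, decodes c (d k.+1) (d (t k))) ->
  exists m, (forall k, decodes m (d k.+1) (d (t k))) /\
    forall c, (forall k, decodes c (d k.+1) (d (t k))) -> m <= c.
Proof.
move=> [c0 hc0]; pose C := [set c | forall k, decodes c (d k.+1) (d (t k))].
have hC : has_inf C.
  split; first by exists c0.
  by exists 0 => c /(_ 0%N) /decodes_sub /andP[/ltW].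
pose m := inf C.
have mlb c : C c -> m <= c by move=> Cc; apply: (inf_lbound hC.2 Cc).
exists m; split; last exact: mlb.
have [Cm //|nCm] := pselect (C m).
have mlt c : C c -> m < c.
  move=> Cc; rewrite lt_neqAle mlb // andbT.
  by apply/eqP => mc; apply: nCm; rewrite mc.
have mglb x : m < x -> exists2 c, C c & c < x.
  by move=> /(inf_lt hC.1) [c Cc cx]; exists c.
move=> k; set x := d k.+1; set y := d (t k).
have [fr [mfr _ free]] : exists fr, [/\ m < fr, fr <= m + 1
    & forall z, E z -> m < z < fr -> ~ le z x].
  by apply: (stage_free_right le_fin (d_E k.+1)); lra.
have [c1 Cc1 c1fr] := mglb _ mfr.
have [l [r [p /andP[lc cr] Ny yc ymax]]] := Cc1 k.
have [[El lx] [Er rx] lr pfree] := p.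
have mc1 := mlt _ Cc1.
have lm : l <= m.
  rewrite leNgt; apply/negP => ml; apply: (free l) lx => //.
  by rewrite ml (lt_trans lc).
(* If the ratio fell short of [y] at [m], it would fall short at codes close enough to [m]. *)
have ym : y * (r - l) <= m - l.
  rewrite leNgt; apply/negP => ym.
  have [c Cc cm] : exists2 c, C c & c < Num.min c1 (y * (r - l) + l).
    by apply: mglb; rewrite lt_min mc1 /=; lra.
  move: cm; rewrite lt_min => /andP[cc1 cy].
  have lcr : l < c < r by rewrite (le_lt_trans lm (mlt _ Cc)) (lt_trans cc1).
  have [l' [r' [p' lcr' _ yc' _]]] := Cc k.
  have [el er] := piece_unique p p' lcr lcr'; subst l' r'.
  by move: yc'; rewrite -/y; lra.
(* Positivity of [y] turns [y * (r - l) <= m - l] into [l < m]. *)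
have y0 : 0 < y by have /andP[] := E_sub (d_E (t k)).
exists l, r; split=> //.
- have : 0 < y * (r - l) by apply: mulr_gt0 => //; rewrite subr_gt0.
  by move=> h; apply/andP; split; lra.
- by move=> y' Ny' y'x y'm; apply: ymax => //; lra.
Qed.

(** A set is stored by bits: at each stage after the first, [d 1] stands for membership and [d 0]
    for its failure. The first stage has [d 0] as its only spine point and carries no bit. *)
Definition is_code (c : R) : Prop := forall x, N x -> d 0%N < x ->
  decodes c x (d 0%N) \/ decodes c x (d 1%N).

(** Many reals code one set; choosing the least makes equality of sets equality of codes. *)
Definition canonical_code (c : R) : Prop := is_code c /\ forall c', c' < c ->
  is_code c' -> ~ (forall x, N x -> d 0%N < x ->
                     (decodes c x (d 1%N) <-> decodes c' x (d 1%N))).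

Lemma canonical_codes : exists h : set nat -> R,
  [/\ set_bij [set: set nat] canonical_code h
    & forall k S, S k <-> decodes (h S) (d k.+1) (d 1%N)].
Proof.
pose t (S : set nat) k : nat := `[< S k >].
have codeE S c : (forall k, decodes c (d k.+1) (d (t S k))) <->
    is_code c /\ forall k, S k <-> decodes c (d k.+1) (d 1%N).
  split=> [H|[cc H] k].
    split=> [_ /N_spine [[|k] ->]|k]; rewrite ?ltxx //.
      by move=> _; have := H k; rewrite /t; case: asboolP; tauto.
    split=> [Sk|h]; first by have := H k; rewrite /t asboolT.
    apply: contrapT => nS; have := H k; rewrite /t asboolF // => h'.
    by have /spine_inj := decodes_fun h h'.
  rewrite /t; case: asboolP => Sk; first exact/H.
  have [||//|/H //] := cc (d k.+1); first by apply/N_spine; exists k.+1.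
  exact: d_mono.
have /choice [h hh] : forall S : set nat, exists m,
    (forall k, decodes m (d k.+1) (d (t S k))) /\
    forall c, (forall k, decodes c (d k.+1) (d (t S k))) -> m <= c.
  move=> S; apply: least_code.
  (* The bit of [j] is stored at stage [j + 1], where index 1 is admissible. *)
  have [k|c hc] := @code_exists (fun k => if k is j.+1 then t S j else 0%N).
    by case: k => // k; apply: leq_trans (leq_b1 _) _.
  by exists c => k; apply: (hc k.+1).
have hcode S : is_code (h S) /\ forall k, S k <-> decodes (h S) (d k.+1) (d 1%N).
  by apply/codeE; have [] := hh S.
have hmin S c : is_code c -> (forall k, S k <-> decodes c (d k.+1) (d 1%N)) ->
    h S <= c.
  by move=> cc hc; have [_] := hh S; apply; apply/codeE.
exists h; split; last by move=> k S; have [_] := hcode S.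
split.
- move=> S _ /=; split; first by have [] := hcode S.
  move=> c' c'h cc' H; move: c'h; rewrite ltNge => /negP; apply.
  apply: hmin => // k; have [_ ->] := hcode S; apply: H; last exact: d_mono.
  by apply/N_spine; exists k.+1.
- move=> S T _ _ hST; apply/funext => k; apply/propext.
  by have [_ ->] := hcode S; have [_ ->] := hcode T; rewrite hST.
- move=> c [cc cmin].
  pose S : set nat := fun k => decodes c (d k.+1) (d 1%N).
  exists S => //; have := hmin S c cc (fun k => iff_refl _).
  rewrite le_eqVlt => /orP[/eqP //|hc]; exfalso.
  apply: (cmin _ hc (hcode S).1) => x /N_spine [[|k] ->]; rewrite ?ltxx // => _.
  by have [_ <-] := hcode S.
Qed.

(** A ternary relation as a list of triples, so that an operation on the spine costs only three real
    parameters. *)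
Definition coded_op (F G H x y z : R) : Prop := exists k,
  [/\ N k, d 0%N < k, decodes F k x, decodes G k y & decodes H k z].

(* The pair [(logn 2 k, logn 3 k)] runs over all pairs, and is small enough
   compared with [k] for its sum and product to be coded at stage [k]. *)
Lemma logn23_bound k :
  ((logn 2 k * logn 3 k + logn 2 k + logn 3 k) <= k)%N.
Proof.
case: k => [|k]; first by rewrite !logn0.
have : (2 ^ logn 2 k.+1 * 3 ^ logn 3 k.+1 <= k.+1)%N.
  apply: dvdn_leq => //; rewrite Gauss_dvd ?pfactor_dvdnn //.
  by rewrite coprimeXl // coprimeXr.
(* With [i] and [j] the two exponents, [(i + 1) * (j + 1) <= 2 ^ i * 3 ^ j]. *)
have h2 : (logn 2 k.+1 < 2 ^ logn 2 k.+1)%N by apply: ltn_expl.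
have h3 : (logn 3 k.+1 < 3 ^ logn 3 k.+1)%N by apply: ltn_expl.
have := leq_mul h2 h3; set i := logn 2 _; set j := logn 3 _ => h h'.
by have := leq_trans h h'; rewrite mulSn mulnS; lia.
Qed.

(** The triple at stage [k + 1] consists of [logn 2 k], [logn 3 k] and their value under [op], each
    number [i] being represented by [d i.+1]. The bound on [op] covers sums and products and keeps
    the value at most [k]. *)
Lemma coded_opP (op : nat -> nat -> nat) :
  (forall i j, op i j <= i * j + i + j)%N ->
  exists F G H, forall i j z,
    coded_op F G H (d i.+1) (d j.+1) z <-> z = d (op i j).+1.
Proof.
move=> op_le.
have code (s : nat -> nat) : (forall k, s k <= k)%N ->
    exists c, forall k, decodes c (d k.+1) (d (s k).+1).
  move=> sk; have [[//|k]|c hc] := @code_exists (fun k => if k is j.+1 then (s j).+1 else 0%N).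
    exact: sk.
  by exists c => k; apply: (hc k.+1).
have [|F hF] := code (logn 2); first by move=> k; have := logn23_bound k; lia.
have [|G hG] := code (logn 3); first by move=> k; have := logn23_bound k; lia.
have [|H hH] := code (fun k => op (logn 2 k) (logn 3 k)).
  by move=> k; apply: leq_trans (op_le _ _) (logn23_bound k).
exists F, G, H => i j z; split=> [[x [/N_spine [[|k] ->]]]|->].
- by rewrite ltxx.
- move=> _ /(decodes_fun (hF k)) /spine_inj [<-] /(decodes_fun (hG k)) /spine_inj [<-].
  by move=> /(decodes_fun (hH k)) ->.
pose k := (2 ^ i * 3 ^ j)%N.
have ki : logn 2 k = i.
  by rewrite lognM ?expn_gt0 // !lognX logn_prime // logn_prime //= muln1 muln0 addn0.
have kj : logn 3 k = j.
  by rewrite lognM ?expn_gt0 // !lognX logn_prime // logn_prime //= muln1 muln0.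
exists (d k.+1); split.
- by apply/N_spine; exists k.+1.
- exact: d_mono.
- by rewrite -ki.
- by rewrite -kj.
- by have := hH k; rewrite ki kj.
Qed.

End Codes.

(** * Slopes of definable germs *)

Section Germs.
Variable R : realType.

(** Fixing 0 allows germs to be composed, so that slopes can be multiplied. *)
Definition germ (G : R -> R) (s : R) : Prop :=
  G 0 = 0 /\ is_derive (0 : R) (1 : R) G s.

Lemma germD G1 s1 G2 s2 : germ G1 s1 -> germ G2 s2 ->
  germ (fun x => G1 x + G2 x) (s1 + s2).
Proof.
move=> [z1 d1] [z2 d2]; split; first by rewrite z1 z2 addr0.
exact: is_deriveD.
Qed.

Lemma germN G s : germ G s -> germ (fun x => - G x) (- s).
Proof. by move=> [z d]; split; [rewrite z oppr0|exact: is_deriveN]. Qed.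

Lemma germ_comp G1 s1 G2 s2 : germ G1 s1 -> germ G2 s2 ->
  germ (fun x => G1 (G2 x)) (s1 * s2).
Proof.
move=> [z1 d1] [z2 d2]; split; first by rewrite z2.
by apply: (is_derive1_comp (f := G1)) => //; rewrite z2.
Qed.

Lemma germ_translate (f : R -> R) (a s : R) :
  is_derive a 1 f s -> germ (fun x => f (a + x) - f a) s.
Proof.
move=> d; split; first by rewrite addr0 subrr.
have d' : is_derive (0 : R) (1 : R) (f \o shift a) (s * 1).
  by apply: is_derive1_comp; [rewrite /= add0r|exact: is_derive_shift].
have := is_deriveB d' (is_derive_cst (f a) (0 : R) (1 : R)).
rewrite mulr1 subr0.
suff -> : (f \o shift a) - cst (f a) = (fun x => f (a + x) - f a) by [].
by apply: funext => x; rewrite [a + x]addrC.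
Qed.

Lemma germ_gt0 G s : germ G s -> 0 < s ->
  exists2 eta, 0 < eta & forall x, 0 < x < eta -> 0 < G x.
Proof.
move=> [G0 [dG eqs]] s0.
have cv : h^-1 *: ((G \o shift 0) (h *: 1) - G 0) @[h --> (0 : R)^'] --> s.
  by rewrite -eqs; exact: dG.
have [/= eta eta0 H] := cvgr_gt s cv 0 s0.
exists eta => // x /andP[x0 xe].
have := H x; rewrite /= /ball_ sub0r normrN gtr0_norm // => /(_ xe (lt0r_neq0 x0)).
rewrite G0 subr0 addr0 [x *: 1]mulr1 [_ *: _]/(x^-1 * G x).
by rewrite pmulr_rgt0 // invr_gt0.
Qed.

Lemma germ_lt G1 s1 G2 s2 : germ G1 s1 -> germ G2 s2 -> s1 < s2 ->
  exists2 eta, 0 < eta & forall x, 0 < x < eta -> G1 x < G2 x.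
Proof.
move=> g1 g2 s12; have [|eta eta0 H] := germ_gt0 (germD g2 (germN g1)).
  by rewrite subr_gt0.
by exists eta => // x /H; rewrite subr_gt0.
Qed.

Lemma germ_le G1 s1 G2 s2 : germ G1 s1 -> germ G2 s2 ->
  (exists2 eta, 0 < eta & forall x, 0 < x < eta -> G1 x < G2 x) -> s1 <= s2.
Proof.
move=> g1 g2 [eta eta0 H]; rewrite leNgt; apply/negP => s21.
have [eta' eta'0 H'] := germ_lt g2 g1 s21.
pose m := Num.min eta eta' / 2.
have m0 : 0 < Num.min eta eta' by rewrite lt_min eta0.
have m1 : Num.min eta eta' <= eta by rewrite ge_min lexx.
have m2 : Num.min eta eta' <= eta' by rewrite ge_min lexx orbT.
have := H m; have := H' m; rewrite /m => h h'.
suff : false by []; rewrite -(lt_asym (G1 m) (G2 m)); apply/andP; split.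
  by apply: h'; apply/andP; split; lra.
by apply: h; apply/andP; split; lra.
Qed.

End Germs.

(** * Definability of sign conditions on slopes *)

Section Slopes.
Variables (R : realType) (M : expansion R) (phi g : R -> R) (p q : R).
Hypothesis pq : p < q.
Hypothesis phi_def : dset M (fun v => v 0%N = phi (v 1%N)).
Hypothesis phi_der : forall x, p <= x <= q -> is_derive x 1 phi (g x).
Hypothesis g_cvg : forall x, p <= x <= q -> {for x, continuous g}.
Hypothesis g_gt : forall x, p < x <= q -> g p < g x.

(** The family of germs is definable uniformly in [v]; its slope [S] need not be a definable
    function. *)
Definition slope_fun (D : (nat -> R) -> Prop) (S : (nat -> R) -> R) : Prop :=
  exists2 G : R -> (nat -> R) -> R,
    dfun M (fun v => G (v 0%N) (fun k => v k.+1))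
    & forall v, D v -> germ (G ^~ v) (S v).

Variable D : (nat -> R) -> Prop.

Lemma slope_var i : (forall v, D v -> p <= v i <= q) ->
  slope_fun D (fun v => g (v i)).
Proof.
move=> Di; exists (fun x v => phi (v i + x) - phi (v i)).
  by apply: dfun_sub; apply: (dfun_app1 (f := phi)) => //; repeat dset_step.
by move=> v /Di h; apply: germ_translate; apply: phi_der.
Qed.

Lemma slope_const c : p <= c <= q -> slope_fun D (fun=> g c).
Proof.
move=> hc; exists (fun x v => phi (c + x) - phi c).
  by apply: dfun_sub; apply: (dfun_app1 (f := phi)) => //; repeat dset_step.
by move=> v _; apply: germ_translate; apply: phi_der.
Qed.

Lemma slopeD S T : slope_fun D S -> slope_fun D T ->
  slope_fun D (fun v => S v + T v).
Proof.
move=> [G dG hG] [H dH hH]; exists (fun x v => G x v + H x v).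
  exact: dfun_add.
by move=> v Dv; apply: germD; [exact: hG|exact: hH].
Qed.

Lemma slopeN S : slope_fun D S -> slope_fun D (fun v => - S v).
Proof.
move=> [G dG hG]; exists (fun x v => - G x v); first exact: dfun_opp.
by move=> v Dv; apply: germN; exact: hG.
Qed.

Lemma slopeB S T : slope_fun D S -> slope_fun D T ->
  slope_fun D (fun v => S v - T v).
Proof. by move=> hS hT; apply: slopeD => //; apply: slopeN. Qed.

Lemma slopeM S T : slope_fun D S -> slope_fun D T ->
  slope_fun D (fun v => S v * T v).
Proof.
move=> [G dG hG] [H dH hH]; exists (fun x v => G (H x v) v).
  apply: (dfun_subst (f := fun y v => G y (fun k => v k.+1))) dH.
  exact: (dset_rename (fun k => if k is j.+2 then k.+1 else k)) dG.
by move=> v Dv; apply: (germ_comp (G1 := G ^~ v)); [exact: hG|exact: hH].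
Qed.

Lemma small_slope s : 0 < s -> exists2 c, p < c < q & g c - g p < s.
Proof.
move=> s0; have := g_cvg (x := p); rewrite lexx (ltW pq) => /(_ isT).
move=> /(cvgrPdist_lt g) /(_ _ s0) [/= eta eta0 H].
pose c := p + Num.min eta (q - p) / 2.
have m0 : 0 < Num.min eta (q - p) by rewrite lt_min eta0 subr_gt0.
have m1 : Num.min eta (q - p) <= eta by rewrite ge_min lexx.
have m2 : Num.min eta (q - p) <= q - p by rewrite ge_min lexx orbT.
exists c; first by rewrite /c; apply/andP; split; lra.
have : `|g p - g c| < s.
  by apply: H; rewrite /ball_ /= /c opprD addrA subrr sub0r normrN gtr0_norm; lra.
by rewrite distrC => /(le_lt_trans (ler_norm _)).
Qed.

(* A positive slope is one exceeding some [g c - g p]. *)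
Lemma dset_slope_gt0 S : dset M D -> slope_fun D S ->
  dset M (fun v => D v /\ 0 < S v).
Proof.
move=> dD [G dG hG].
have dH : dset M (fun v => D v /\ exists c, (p < c < q) /\ exists eta, 0 < eta /\
   forall x, 0 < x < eta -> (phi (c + x) - phi c) - (phi (p + x) - phi p) < G x v).
  apply: dset_and => //; apply: dset_ex; apply: dset_and; first by repeat dset_step.
  apply: dset_ex; apply: dset_and; first by repeat dset_step.
  apply: dset_all; apply: dset_imp; first by repeat dset_step.
  apply: dset_lt.
    by repeat first [apply: (dfun_app1 (f := phi)) => //|dset_step].
  exact: (dset_rename (fun k => if k is j.+2 then j.+4 else k)) dG.
apply: dset_iff dH => v; split=> -[Dv H]; split=> //; last first.
  have [c cpq cs] := small_slope H; exists c; split=> //.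
  have /andP[pc cq] := cpq.
  have hc : p <= c <= q by rewrite !ltW.
  have hp : p <= p <= q by rewrite lexx ltW.
  have [eta eta0 h] := germ_lt (germD (germ_translate (phi_der hc))
     (germN (germ_translate (phi_der hp)))) (hG v Dv) cs.
  by exists eta; split.
have [c [/andP[pc cq] [eta [eta0 h]]]] := H.
have hc : p <= c <= q by rewrite !ltW.
have hp : p <= p <= q by rewrite lexx ltW.
(* Domination of germs gives only the weak inequality [g c - g p <= S v], but its left side is
   positive. *)
apply: lt_le_trans (germ_le (germD (germ_translate (phi_der hc))
     (germN (germ_translate (phi_der hp)))) (hG v Dv) _).
  by rewrite subr_gt0 g_gt // pc ltW.
by exists eta.
Qed.

Lemma dset_slope_ge0 S : dset M D -> slope_fun D S ->
  dset M (fun v => D v /\ 0 <= S v).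
Proof.
move=> dD hS.
apply: dset_iff (dset_and dD (dset_not (dset_slope_gt0 dD (slopeN hS)))) => v.
split=> -[Dv h]; split=> //.
  by rewrite leNgt; apply/negP => S0; apply: h; rewrite oppr_gt0.
by move=> [_]; rewrite oppr_gt0 ltNge h.
Qed.

Lemma dset_slope_eq0 S : dset M D -> slope_fun D S ->
  dset M (fun v => D v /\ S v = 0).
Proof.
move=> dD hS.
apply: dset_iff (dset_and (dset_slope_ge0 dD hS)
  (dset_slope_ge0 dD (slopeN hS))) => v.
split=> [[[Dv h1] [_ h2]]|[Dv ->]]; last by rewrite oppr0.
by split=> //; apply/eqP; rewrite eq_le h1 andbT -oppr_ge0.
Qed.

End Slopes.

(** * First and last points at which a continuous function takes a value *)

Section Continuity.
Variables (R : realType) (g : R -> R).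

Lemma continuous_lt_near x B : {for x, continuous g} -> g x < B ->
  exists2 eta, 0 < eta & forall y, `|y - x| < eta -> g y < B.
Proof.
move=> cg gB; have [/= eta eta0 H] := cvgr_lt (g x) cg B gB.
by exists eta => // y; rewrite distrC => /H.
Qed.

Lemma continuous_gt_near x B : {for x, continuous g} -> B < g x ->
  exists2 eta, 0 < eta & forall y, `|y - x| < eta -> B < g y.
Proof.
move=> cg gB; have [/= eta eta0 H] := cvgr_gt (g x) cg B gB.
by exists eta => // y; rewrite distrC => /H.
Qed.

(** The infimum of the points with [B <= g x]. If [g] were below [B] there, it would be so at points
    just after; if above, at points just before. *)
Lemma first_hit u w B : u < w -> (forall x, u <= x <= w -> {for x, continuous g}) ->
  g u < B -> B <= g w ->
  exists x, [/\ u < x <= w, g x = B & forall y, u <= y < x -> g y < B].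
Proof.
move=> uw cg gu gw; pose A := [set x | u <= x <= w /\ B <= g x].
have hA : has_inf A.
  split; first by exists w; split=> //; rewrite lexx ltW.
  by exists u => x [/andP[]].
pose q := inf A.
have qlb x : A x -> q <= x by move=> Ax; apply: (inf_lbound hA.2 Ax).
have uq : u <= q by apply: lb_le_inf; [exact: hA.1|move=> x [/andP[]]].
have qw : q <= w by apply: qlb; split=> //; rewrite lexx ltW.
have below y : u <= y < q -> g y < B.
  move=> /andP[uy yq]; rewrite ltNge; apply/negP => gy.
  have : A y by split=> //; rewrite uy (le_trans (ltW yq)).
  by move/qlb; rewrite leNgt yq.
have gqB : B <= g q.
  rewrite leNgt; apply/negP => gq.
  have [|eta eta0 H] := continuous_lt_near _ gq; first by apply: cg; rewrite uq.
  have [|a Aa aq] := @inf_lt _ A (q + eta) hA.1; first by rewrite ltrDl.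
  have qa := qlb _ Aa.
  have : g a < B by apply: H; rewrite ger0_norm; lra.
  by rewrite ltNge; case: Aa => _ ->.
have uq' : u < q.
  by rewrite lt_neqAle uq andbT; apply: contraTneq gu => ->; rewrite -leNgt.
exists q; split=> //; first by rewrite uq'.
apply/eqP; rewrite eq_le gqB andbT leNgt; apply/negP => Bq.
have [|eta eta0 H] := continuous_gt_near _ Bq; first by apply: cg; rewrite uq.
pose m := Num.min eta (q - u) / 2.
have m0 : 0 < Num.min eta (q - u) by rewrite lt_min eta0 subr_gt0.
have m1 : Num.min eta (q - u) <= eta by rewrite ge_min lexx.
have m2 : Num.min eta (q - u) <= q - u by rewrite ge_min lexx orbT.
have : B < g (q - m).
  by apply: H; rewrite addrAC subrr sub0r normrN gtr0_norm /m; lra.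
by rewrite ltNge ltW // below // /m; apply/andP; split; lra.
Qed.

End Continuity.

(** The mirror image of [first_hit], through [x |-> - g (- x)]. *)
Lemma last_hit (R : realType) (g : R -> R) (u w B : R) : u < w ->
  (forall x, u <= x <= w -> {for x, continuous g}) -> g u <= B -> B < g w ->
  exists x, [/\ u <= x < w, g x = B & forall y, x < y <= w -> B < g y].
Proof.
move=> uw cg gu gw.
have [||||x [/andP[xw xu] gx H]] := @first_hit R (fun x => - g (- x)) (- w) (- u) (- B).
- by rewrite ltrN2.
- move=> x /andP[x1 x2]; apply: (cvgN (f := fun x => g (- x))).
  apply: continuous_comp; first exact: opp_continuous.
  by apply: cg; apply/andP; split; lra.
- by rewrite opprK ltrN2.
- by rewrite opprK lerN2.
exists (- x); split; first by apply/andP; split; lra.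
  by apply: oppr_inj.
move=> y /andP[y1 y2]; have : - w <= - y < x by apply/andP; split; lra.
by move/H; rewrite opprK ltrN2.
Qed.

(** * Transport of the real field when the slope is increasing *)

Section FieldType.
Variables (R : realType) (M : expansion R) (phi g : R -> R) (p q : R).
Hypothesis pq : p < q.
Hypothesis phi_def : dset M (fun v => v 0%N = phi (v 1%N)).
Hypothesis phi_der : forall x, p <= x <= q -> is_derive x 1 phi (g x).
Hypothesis g_cvg : forall x, p <= x <= q -> {for x, continuous g}.
Hypothesis g_inc : forall x y, p <= x -> x < y -> y <= q -> g x < g y.

Lemma definable_op1_dset (J : set R) (op : R -> R -> R) :
  dset M (fun v => [/\ J (v 0%N), J (v 1%N) & v 2%N = op (v 0%N) (v 1%N)]) ->
  definable_op1 M J op.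
Proof.
move=> H; apply/definable_dset; apply: dset_iff H => v.
have vE : [tuple v i | i < 3] = [tuple v 0%N; v 1%N; v 2%N].
  by apply: eq_from_tnth => -[[|[|[|i]]] hi] //; rewrite tnth_mktuple.
rewrite vE; split=> [[J0 J1 ->]|[x Jx [y Jy eq_t]]].
  by exists (v 0%N) => //; exists (v 1%N).
by move/(congr1 val): eq_t => /= [<- <- <-].
Qed.

Let chart (a : R) : R := (g q - g a)^-1 - (g a - g p)^-1.

Let between a : p < a < q -> 0 < g q - g a /\ 0 < g a - g p.
Proof. by move=> /andP[pa aq]; rewrite !subr_gt0 !g_inc // ltW. Qed.

Let chart_inc a b : p < a < q -> p < b < q -> a < b -> chart a < chart b.
Proof.
move=> ha hb ab; have [a1 a2] := between ha; have [b1 b2] := between hb.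
have gab : g a < g b.
  by move: ha hb => /andP[? ?] /andP[? ?]; apply: g_inc => //; apply: ltW.
rewrite /chart; apply: ltrB; rewrite ltf_pV2 ?posrE //; lra.
Qed.

(* Clearing denominators in [chart a = x], so that the intermediate value
   theorem applies on the closed interval. *)
Let chart_surj x : exists2 a, p < a < q & chart a = x.
Proof.
pose P a := x * ((g q - g a) * (g a - g p)) - ((g a - g p) - (g q - g a)).
have gpq : g p < g q by apply: g_inc.
have Pp : P p = g q - g p by rewrite /P; ring.
have Pq : P q = - (g q - g p) by rewrite /P; ring.
have [|||a] := @IVT R P p q 0.
- exact: ltW.
- apply: continuous_in_subspaceT => a; rewrite inE /= in_itv /= => hab.
  have ga := g_cvg hab.
  have c1 : g q - g x0 @[x0 --> a] --> g q - g a by apply: cvgB => //; apply: cvg_cst.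
  have c2 : g x0 - g p @[x0 --> a] --> g a - g p by apply: cvgB => //; apply: cvg_cst.
  by apply: cvgB; [apply: cvgM; [apply: cvg_cst|apply: cvgM]|apply: cvgB].
- by rewrite Pp Pq ge_min le_max; apply/andP; split; apply/orP; [right|left]; lra.
rewrite in_itv /= => /andP[pa aq] Pa.
have pa' : p < a.
  by rewrite lt_neqAle pa andbT; apply/eqP => pa'; move: Pa; rewrite -pa' Pp; lra.
have aq' : a < q.
  by rewrite lt_neqAle aq andbT; apply/eqP => qa'; move: Pa; rewrite qa' Pq; lra.
have hab : p < a < q by rewrite pa'.
exists a => //; have [h1 h2] := between hab.
have n1 : g q - g a != 0 by rewrite gt_eqF.
have n2 : g a - g p != 0 by rewrite gt_eqF.
apply: (mulIf (mulf_neq0 n1 n2)).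
have -> : chart a * ((g q - g a) * (g a - g p)) = (g a - g p) - (g q - g a).
  by rewrite /chart; field; rewrite n1 n2.
by apply/eqP; rewrite eq_sym -subr_eq0; apply/eqP.
Qed.

Lemma field_type_of_increasing_slope : field_type M.
Proof.
have /choice [h hh] : forall x, exists a, p < a < q /\ chart a = x.
  by move=> x; have [a] := chart_surj x; exists a.
have hJ x : p < h x < q by have [] := hh x.
have chartK x : chart (h x) = x by have [] := hh x.
have chart_inj a b : p < a < q -> p < b < q -> chart a = chart b -> a = b.
  move=> ha hb eq_ab; case: (ltgtP a b) => // ab.
    by have := chart_inc ha hb ab; rewrite eq_ab ltxx.
  by have := chart_inc hb ha ab; rewrite eq_ab ltxx.
have hK a : p < a < q -> h (chart a) = a by move=> ha; apply: chart_inj.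
exists p, q, (fun a b => h (chart a + chart b)), (fun a b => h (chart a * chart b)).
pose D (v : nat -> R) := [/\ p < v 0%N < q, p < v 1%N < q & p < v 2%N < q].
have dD : dset M D by rewrite /D; repeat dset_step.
have g_gt x : p < x <= q -> g p < g x by move=> /andP[? ?]; apply: g_inc.
have sv i : (i < 3)%N -> slope_fun M D (fun v => g (v i)).
  move=> i3; apply: (slope_var phi_def phi_der) => v [h0 h1 h2].
  by case: i i3 => [|[|[|//]]] _;
    [move/andP: h0|move/andP: h1|move/andP: h2] => -[? ?]; rewrite !ltW.
have sp : slope_fun M D (fun=> g p).
  by apply: (slope_const phi_def phi_der); rewrite lexx ltW.
have sq : slope_fun M D (fun=> g q).
  by apply: (slope_const phi_def phi_der); rewrite lexx ltW.
(* In this notation [chart (v i)] is [(W i v - U i v) / (U i v * W i v)]. *)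
pose U i (v : nat -> R) := g q - g (v i); pose W i (v : nat -> R) := g (v i) - g p.
have sU i : (i < 3)%N -> slope_fun M D (U i) by move=> i3; apply: slopeB => //; apply: sv.
have sW i : (i < 3)%N -> slope_fun M D (W i) by move=> i3; apply: slopeB => //; apply: sv.
have nz v : D v -> forall i, (i < 3)%N -> U i v != 0 /\ W i v != 0.
  by move=> [h0 h1 h2] [|[|[|//]]] _; rewrite /U /W;
    [have [? ?] := between h0|have [? ?] := between h1|have [? ?] := between h2];
    rewrite !gt_eqF.
(* The graph is given by an equation between charts; multiplied by the nonzero product of all
   denominators, it becomes the vanishing of a slope. *)
have key (op : R -> R -> R) S : slope_fun M D S ->
    (forall v, D v -> S v = (op (chart (v 0%N)) (chart (v 1%N)) - chart (v 2%N)) *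
       (U 0%N v * W 0%N v * (U 1%N v * W 1%N v) * (U 2%N v * W 2%N v))) ->
    definable_op1 M `]p, q[%classic (fun a b => h (op (chart a) (chart b))).
  move=> sS SE; apply: definable_op1_dset.
  apply: dset_iff (dset_slope_eq0 pq phi_def phi_der g_cvg g_gt dD sS) => v.
  rewrite /= !in_itv /=; split=> [[Dv]|[h0 h1 h2]].
    have [n0 n0'] := nz _ Dv 0%N isT; have [n1 n1'] := nz _ Dv 1%N isT.
    have [n2 n2'] := nz _ Dv 2%N isT.
    rewrite SE // => /eqP; rewrite mulf_eq0 !mulf_eq0.
    rewrite (negbTE n0) (negbTE n0') (negbTE n1) (negbTE n1') (negbTE n2) (negbTE n2').
    rewrite !orbF subr_eq0 => /eqP opE; have [h0 h1 h2] := Dv; split=> //.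
    by rewrite opE hK.
  have Dv : D v by split=> //; rewrite h2 hJ.
  by split=> //; rewrite SE // h2 chartK subrr mul0r.
split=> //.
- by move=> x y _ _ /=; rewrite !in_itv /=.
- apply: (key +%R (fun v => (W 0%N v - U 0%N v) * (U 1%N v * W 1%N v * (U 2%N v * W 2%N v))
     + (W 1%N v - U 1%N v) * (U 0%N v * W 0%N v * (U 2%N v * W 2%N v))
     - (W 2%N v - U 2%N v) * (U 0%N v * W 0%N v * (U 1%N v * W 1%N v)))).
    by repeat first [exact: sU|exact: sW|apply: slopeB|apply: slopeD|apply: slopeM].
  move=> v Dv; rewrite /chart -!/(U _ v) -!/(W _ v).
  have [n0 n0'] := nz _ Dv 0%N isT; have [n1 n1'] := nz _ Dv 1%N isT.
  have [n2 n2'] := nz _ Dv 2%N isT.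
  by field; rewrite n0 n0' n1 n1' n2 n2'.
- apply: (key *%R (fun v => (W 0%N v - U 0%N v) * (W 1%N v - U 1%N v) * (U 2%N v * W 2%N v)
     - (W 2%N v - U 2%N v) * (U 0%N v * W 0%N v * (U 1%N v * W 1%N v)))).
    by repeat first [exact: sU|exact: sW|apply: slopeB|apply: slopeD|apply: slopeM].
  move=> v Dv; rewrite /chart -!/(U _ v) -!/(W _ v).
  have [n0 n0'] := nz _ Dv 0%N isT; have [n1 n1'] := nz _ Dv 1%N isT.
  have [n2 n2'] := nz _ Dv 2%N isT.
  by field; rewrite n0 n0' n1 n1' n2 n2'.
exists h; split.
- split=> [x _|x y _ _ hxy|a /=].
  + by rewrite /= in_itv /=.
  + by rewrite -(chartK x) hxy chartK.
  + by rewrite in_itv /= => ha; exists (chart a) => //; apply: hK.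
- move=> x y; apply/idP/idP => xy.
    rewrite ltNge le_eqVlt; apply/negP => /orP[/eqP hyx|/chart_inc].
      by move: xy; rewrite -(chartK x) -(chartK y) hyx ltxx.
    by rewrite !chartK !hJ => /(_ isT isT) yx; have := lt_trans xy yx; rewrite ltxx.
  by have := chart_inc (hJ x) (hJ y) xy; rewrite !chartK.
- by move=> x y; rewrite !chartK.
- by move=> x y; rewrite !chartK.
Qed.

End FieldType.

(** * Second-order arithmetic *)

Section Values.
(* [w] interprets every real as an element of the value space [(0, gam)]. *)
Variables (R : realType) (M : expansion R) (gam : R) (w : R -> R).
Variables (E : R -> Prop) (le : R -> R -> Prop).
Hypothesis gam0 : 0 < gam.
Hypothesis gam1 : gam <= 1.
Hypothesis E_sub : forall e, E e -> 0 < e < gam.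
Hypothesis E_dense : forall u w : R, 0 <= u -> u < w -> w <= gam ->
  exists2 e, E e & u < e < w.
Hypothesis le_tot : forall x y, E x -> E y -> le x y \/ le y x.
Hypothesis le_tr : forall x y z, le x y -> le y z -> le x z.
Hypothesis le_fin : forall e, E e ->
  exists s : seq R, forall z, E z -> le z e -> z \in s.
Hypothesis w_surj : forall e : R, 0 < e < gam -> exists x, w x = e.
Hypothesis dset_wlt0 : dset M (fun v => w (v 0%N) < w (v 1%N)).
Hypothesis dset_wE0 : dset M (fun v => E (w (v 0%N))).
Hypothesis dset_wle0 : dset M (fun v => le (w (v 0%N)) (w (v 1%N))).
Hypothesis dset_wratio0 : dset M (fun v =>
  w (v 0%N) * (w (v 1%N) - w (v 2%N)) <= w (v 3%N) - w (v 2%N)).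

(** A quantifier over values becomes one over the reals interpreted by [w]; as [w] is onto
    [(0, gam)] only, the witnesses must be confined to that interval. *)
Lemma dset_exV (Q : R -> (nat -> R) -> Prop) :
  (forall e v, Q e v -> 0 < e < gam) ->
  dset M (fun v => Q (w (v 0%N)) (fun k => v k.+1)) ->
  dset M (fun v => exists e, Q e v).
Proof.
move=> QV dQ; apply: dset_iff (dset_ex (Q := fun x v => Q (w x) v) dQ) => v.
split=> [[x Qx]|[e Qe]]; first by exists (w x).
by have [x wx] := w_surj (QV _ _ Qe); exists x; rewrite wx.
Qed.

Lemma dset_allV (Q : R -> (nat -> R) -> Prop) :
  (forall e v, ~ Q e v -> 0 < e < gam) ->
  dset M (fun v => Q (w (v 0%N)) (fun k => v k.+1)) ->
  dset M (fun v => forall e, Q e v).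
Proof.
move=> QV dQ.
apply: dset_iff (dset_not (dset_exV (Q := fun e v => ~ Q e v) QV (dset_not dQ))).
move=> v; split=> [H e|H [e]]; last by apply.
by apply: contrapT => nQ; apply: H; exists e.
Qed.

Lemma dset_allE (Q : R -> (nat -> R) -> Prop) :
  dset M (fun v => Q (w (v 0%N)) (fun k => v k.+1)) ->
  dset M (fun v => forall e, E e -> Q e v).
Proof.
move=> dQ; apply: dset_allV; last by apply: dset_imp.
by move=> e v /not_implyP[/E_sub].
Qed.

Lemma dset_wlt i j : dset M (fun v => w (v i) < w (v j)).
Proof.
exact: (dset_app2 (P := fun x y => w x < w y) dset_wlt0 (dfun_var M i) (dfun_var M j)).
Qed.

Lemma dset_wge i j : dset M (fun v => w (v i) <= w (v j)).
Proof.
apply: dset_iff (dset_not (dset_wlt j i)) => v.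
by rewrite leNgt; split=> /negP.
Qed.

Lemma dset_wltc x i : dset M (fun v => w x < w (v i)).
Proof.
exact: (dset_app2 (P := fun x y => w x < w y) dset_wlt0 (dfun_const M x) (dfun_var M i)).
Qed.

Lemma dset_wgtc x i : dset M (fun v => w (v i) < w x).
Proof.
exact: (dset_app2 (P := fun x y => w x < w y) dset_wlt0 (dfun_var M i) (dfun_const M x)).
Qed.

Lemma dset_wgec x i : dset M (fun v => w x <= w (v i)).
Proof.
apply: dset_iff (dset_not (dset_wgtc x i)) => v.
by rewrite leNgt; split=> /negP.
Qed.

Lemma dset_wE i : dset M (fun v => E (w (v i))).
Proof. exact: (dset_app1 (P := fun x => E (w x)) dset_wE0 (dfun_var M i)). Qed.

Lemma dset_wle i j : dset M (fun v => le (w (v i)) (w (v j))).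
Proof.
exact: (dset_app2 (P := fun x y => le (w x) (w y)) dset_wle0 (dfun_var M i)
  (dfun_var M j)).
Qed.

Lemma dset_wratio i j k l : dset M (fun v =>
  w (v i) * (w (v j) - w (v k)) <= w (v l) - w (v k)).
Proof.
exact: (dset_app4 (P := fun a b c d => w a * (w b - w c) <= w d - w c)
  dset_wratio0 (dfun_var M i) (dfun_var M j) (dfun_var M k) (dfun_var M l)).
Qed.

Ltac vstep := first
  [ exact: dset_wlt | exact: dset_wE | exact: dset_wle | exact: dset_wratio
  | exact: dset_wltc | exact: dset_wgtc | exact: dset_wgec | exact: dset_wge
  | assumption ].

Section Spine.
Variables (d0 d1 cs : R).

Let N (e : R) : Prop := [/\ E e, w d0 <= e, e < w cs
  & forall z, E z -> e < z < w cs -> ~ le z e].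

Let N_sub e : N e -> 0 < e < gam. Proof. by move=> [/E_sub]. Qed.

Lemma dset_spine i : dset M (fun v => N (w (v i))).
Proof.
apply: (dset_app1 (P := fun x => N (w x)) _ (dfun_var M i)).
apply: dset_and4; [vstep|vstep|vstep|].
apply: dset_allE; apply: dset_imp; first by apply: dset_andb; vstep.
by apply: dset_not; vstep.
Qed.

Lemma dset_piece i j k : dset M (fun v => piece E le (w (v i)) (w (v j)) (w (v k))).
Proof.
apply: (dset_app3 (P := fun x y z => piece E le (w x) (w y) (w z)) _
  (dfun_var M i) (dfun_var M j) (dfun_var M k)).
apply: dset_and4; [by apply: dset_and; vstep|by apply: dset_and; vstep|vstep|].
apply: dset_allE; apply: dset_imp; first by apply: dset_andb; vstep.
by apply: dset_not; vstep.
Qed.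

Lemma dset_decodes0 :
  dset M (fun v => decodes E le N (w (v 0%N)) (w (v 1%N)) (w (v 2%N))).
Proof.
apply: dset_exV; first by move=> l v [r [[[/E_sub]]]].
apply: dset_exV; first by move=> r v [[_ [/E_sub]]].
apply: dset_and5.
- exact: dset_piece.
- by apply: dset_andb; vstep.
- by apply: dset_and; [exact: dset_spine|vstep].
- vstep.
apply: dset_allV; first by move=> e v /not_implyP[/N_sub].
apply: dset_imp; first exact: dset_spine.
apply: dset_imp; first by vstep.
by apply: dset_imp; vstep.
Qed.

Lemma dset_decodes F G H : dfun M F -> dfun M G -> dfun M H ->
  dset M (fun v => decodes E le N (w (F v)) (w (G v)) (w (H v))).
Proof.
exact: (dset_app3 (P := fun x y z => decodes E le N (w x) (w y) (w z)) dset_decodes0).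
Qed.

Hypothesis N_next : exists2 x, N x & w d0 < x.

Lemma dset_is_code i : dset M (fun v => forall x, N x -> w d0 < x ->
  decodes E le N (w (v i)) x (w d0) \/ decodes E le N (w (v i)) x (w d1)).
Proof.
apply: dset_allV; first by move=> e v /not_implyP[/N_sub].
apply: dset_imp; first exact: dset_spine.
apply: dset_imp; first by vstep.
by apply: dset_or; apply: dset_decodes; repeat dset_step.
Qed.

Lemma dset_canonical_code (d : nat -> R) : d 0%N = w d0 -> d 1%N = w d1 ->
  dset M (fun v => canonical_code E le N d (w (v 0%N))).
Proof.
move=> dE0 dE1; rewrite /canonical_code /is_code dE0 dE1.
apply: dset_and; first exact: dset_is_code.
apply: dset_allV.
  move=> c v /not_implyP[_ /not_implyP[cc _]].
  (* A code decodes something at any spine point after the first, which places it in the value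
     space. *)
  have [x Nx dx] := N_next.
  by case: (cc x Nx dx) => /(decodes_sub E_sub).
apply: dset_imp; first by vstep.
apply: dset_imp; first exact: dset_is_code.
apply: dset_not; apply: dset_allV; first by move=> e v /not_implyP[/N_sub].
apply: dset_imp; first exact: dset_spine.
apply: dset_imp; first by vstep.
by apply: dset_equiv; apply: dset_decodes; repeat dset_step.
Qed.

Lemma dset_coded_op (d : nat -> R) F G H : d 0%N = w d0 ->
  0 < F < gam -> 0 < G < gam -> 0 < H < gam ->
  dset M (fun v => coded_op E le N d F G H (w (v 0%N)) (w (v 1%N)) (w (v 2%N))).
Proof.
move=> dE0 /w_surj [F' <-] /w_surj [G' <-] /w_surj [H' <-].
rewrite /coded_op dE0; apply: dset_exV; first by move=> k v [/N_sub].
apply: dset_and5; [exact: dset_spine|vstep| | |];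
  by apply: dset_decodes; repeat dset_step.
Qed.

End Spine.

Variable X : R -> Prop.
Hypothesis dset_X : dset M (fun v => X (v 0%N)).
Hypothesis X_rep : forall e : R, 0 < e < gam -> exists x, X x /\ w x = e.
Hypothesis X_inj : forall x y, X x -> X y -> w x = w y -> x = y.

Lemma tuple1_thead (t : 1.-tuple R) : t = [tuple thead t].
Proof. by apply: eq_from_tnth => i; rewrite ord1. Qed.

(** [X] selects one real for each value. A set is carried by the representative of its canonical
    code, the number [k] by that of [d k.+1]; [decodes] gives membership and [coded_op] the two
    operations. *)
Lemma copy_PN_of_values : defines_copy_PN M.
Proof.
have [d [cs [dE dmono dle drich [csV base spineP]]]] :=
  spine_exists gam0 gam1 E_sub E_dense le_tot le_tr le_fin.
have dV k : 0 < d k < gam := E_sub (dE k).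
have [a0 wa0] := w_surj (dV 0%N); have [a1 wa1] := w_surj (dV 1%N).
have [acs wcs] := w_surj csV.
pose N e := [/\ E e, w a0 <= e, e < w acs
  & forall z, E z -> e < z < w acs -> ~ le z e].
have NP e : N e <-> exists k, e = d k by rewrite /N wa0 wcs; split=> /spineP.
have Nd k : N (d k) by apply/NP; exists k.
have N_next : exists2 x, N x & w a0 < x by exists (d 1%N); rewrite ?wa0 //; apply: dmono.
have [h [[hA hinj hsurj] hmem]] :=
  canonical_codes gam1 E_sub le_fin dE dmono dle drich base NP.
have canV c : canonical_code E le N d c -> 0 < c < gam.
  move=> [/(_ (d 1%N) (Nd 1%N) (dmono 0%N 1%N isT)) + _].
  by case=> /(decodes_sub E_sub).
have hV S : 0 < h S < gam by apply: canV; apply: hA.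
have /choice [xi xiP] : forall e, exists x, 0 < e < gam -> X x /\ w x = e.
  move=> e; have [/X_rep [x hx]|] := pselect (0 < e < gam); first by exists x.
  by exists 0.
have xiX e : 0 < e < gam -> X (xi e) by move/xiP => [].
have wxi e : 0 < e < gam -> w (xi e) = e by move/xiP => [].
have xiK x : X x -> 0 < w x < gam -> xi (w x) = x.
  by move=> Xx wV; apply: X_inj => //; [apply: xiX|rewrite wxi].
pose A : set (1.-tuple R) :=
  [set t | X (thead t) /\ canonical_code E le N d (w (thead t))].
pose B : set (1.-tuple R) :=
  [set t | [/\ X (thead t), N (w (thead t)) & w a0 < w (thead t)]].
pose gB k := [tuple xi (d k.+1)].
have gBB k : B (gB k).
  by split; rewrite /= ?wxi ?wa0 //; [exact: xiX|exact: dmono].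
have gB_surj t : B t -> exists k, t = gB k.
  move=> [Xt /NP [[|k] tk]]; rewrite tk wa0 ?ltxx // => _; exists k.
  by rewrite /gB -tk xiK ?tk // [LHS]tuple1_thead.
have gB_inj i j : gB i = gB j -> i = j.
  move=> /(congr1 (@thead _ _)) /= eq_ij.
  have /(spine_inj dmono) [] // : d i.+1 = d j.+1.
  by rewrite -(wxi (d i.+1)) // -(wxi (d j.+1)) //; congr w.
(* [idx] inverts [gB], with the arbitrary value 0 outside [B], so that the operations can be total
   functions on tuples. *)
have /choice [idx idxP] : forall t, exists k, B t -> t = gB k.
  move=> t; have [/gB_surj [k ->]|] := pselect (B t); first by exists k.
  by exists 0%N.
have idxK k : idx (gB k) = k by apply: gB_inj; rewrite -idxP.
pose lift_op (op : nat -> nat -> nat) (s t : 1.-tuple R) := gB (op (idx s) (idx t)).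
have dspine : dset M (fun v => N (w (v 0%N))) by apply: dset_spine.
have dB : dset M (fun v => B [tuple v 0%N]).
  apply: dset_and3 => //; exact: dset_wltc.
have dA : dset M (fun v => A [tuple v 0%N]).
  by apply: dset_and => //; exact: (dset_canonical_code (d1 := a1)).
have dBi i : dset M (fun v => B [tuple v i]).
  exact: (dset_app1 (P := fun x => B [tuple x]) dB (dfun_var M i)).
have definable_lift op : (forall i j, op i j <= i * j + i + j)%N ->
    definable_op M B (lift_op op).
  move=> op_le.
  have [F [G [H opP]]] := coded_opP gam1 E_sub le_fin dE dmono dle drich base NP op_le.
  (* The triple for the arguments 0 and 0 shows that each of the three codes decodes something,
     hence lies in the value space. *)
  have [FV GV HV] : [/\ 0 < F < gam, 0 < G < gam & 0 < H < gam].
    have /opP [k [_ _]] : d (op 0%N 0%N).+1 = d (op 0%N 0%N).+1 by [].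
    by do 3![move=> /(decodes_sub E_sub) ?].
  apply/definable_dset.
  have dC : dset M (fun v => coded_op E le N d F G H
    (w (v 0%N)) (w (v 1%N)) (w (v 2%N))) by apply: dset_coded_op.
  apply: dset_iff (dset_and4 (dBi 0%N) (dBi 1%N) (dBi 2%N) dC) => v.
  have vE : [tuple v i | i < 1 + (1 + 1)] =
      [tuple of [tuple v 0%N] ++ [tuple v 1%N] ++ [tuple v 2%N]].
    by apply: eq_from_tnth => -[[|[|[|i]]] hi] //; rewrite tnth_mktuple.
  rewrite vE; split=> [[B0 B1 B2 hC]|[s Bs [t Bt eq_v]]].
    exists [tuple v 0%N] => //; exists [tuple v 1%N] => //.
    congr [tuple of _ ++ _ ++ _].
    have [i e0] := gB_surj _ B0; have [j e1] := gB_surj _ B1.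
    have [k e2] := gB_surj _ B2.
    rewrite e0 e1 e2 /lift_op !idxK.
    have v0 : w (v 0%N) = d i.+1.
      by rewrite -[v 0%N]/(thead [tuple v 0%N]) e0; exact: wxi.
    have v1 : w (v 1%N) = d j.+1.
      by rewrite -[v 1%N]/(thead [tuple v 1%N]) e1; exact: wxi.
    have v2 : w (v 2%N) = d k.+1.
      by rewrite -[v 2%N]/(thead [tuple v 2%N]) e2; exact: wxi.
    by move: hC; rewrite v0 v1 v2 => /opP /(spine_inj dmono) [->].
  have [i es] := gB_surj _ Bs; have [j et] := gB_surj _ Bt.
  move/(congr1 val): eq_v; rewrite es et /lift_op !idxK /= => -[e0 e1 e2].
  rewrite -e0 -e1 -e2 !wxi //; split; try exact: gBB.
  exact/opP.
exists 1%N, 1%N, A, B, (fun s t => decodes E le N (w (thead t)) (w (thead s)) (d 1%N)),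
  (lift_op addn), (lift_op muln); split.
- split; apply/definable_dset.
    apply: dset_iff dA => v.
    by have -> : [tuple v i | i < 1] = [tuple v 0%N]
      by apply: eq_from_tnth => i; rewrite ord1 tnth_mktuple.
  apply: dset_iff dB => v.
  by have -> : [tuple v i | i < 1] = [tuple v 0%N]
    by apply: eq_from_tnth => i; rewrite ord1 tnth_mktuple.
- by move=> s t _ _; split; apply: gBB.
- apply/definable_dset.
  have dD : dset M (fun v => decodes E le N (w (v 1%N)) (w (v 0%N)) (d 1%N)).
    by rewrite -wa1; apply: dset_decodes; repeat dset_step.
  have dA1 : dset M (fun v => A [tuple v 1%N]).
    exact: (dset_app1 (P := fun x => A [tuple x]) dA (dfun_var M 1)).
  apply: dset_iff (dset_and3 (dBi 0%N) dA1 dD) => v.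
  have vE : [tuple v i | i < 1 + 1] = [tuple of [tuple v 0%N] ++ [tuple v 1%N]].
    by apply: eq_from_tnth => -[[|[|i]] hi] //; rewrite tnth_mktuple.
  rewrite vE; split=> [[B0 A1 hD]|[s [t [Bs At hD eq_v]]]].
    by exists [tuple v 0%N], [tuple v 1%N].
  move: Bs At hD eq_v; rewrite (tuple1_thead s) (tuple1_thead t) => Bs At hD.
  by move=> /(congr1 val) /= [-> ->].
- by split; apply: definable_lift => i j; lia.
exists (fun S => [tuple xi (h S)]), gB; split.
- split=> [S _|S T _ _ /(congr1 (@thead _ _)) /= eq_h|t [Xt ct]].
  + by split; rewrite /= ?wxi //; [exact: xiX|exact: hA].
  + by apply: hinj; rewrite ?inE // -(wxi (h S)) // -(wxi (h T)) //; congr w.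
  + have [S _ hS] := hsurj _ ct; exists S => //.
    by rewrite hS xiK //; [rewrite -tuple1_thead|exact: canV].
- split=> [k _|i j _ _|t /gB_surj [k ->]]; [exact: gBB|exact: gB_inj|by exists k].
- by move=> k S; rewrite /= !wxi.
- by move=> i j; rewrite /lift_op !idxK.
- by move=> i j; rewrite /lift_op !idxK.
Qed.

End Values.

(** Each of the [n] successive intervals of length [delta] holds at most one point. *)
Lemma spaced_finite (R : realType) (P : R -> Prop) (a delta : R) (n : nat) :
  0 < delta -> (forall x, P x -> a <= x < a + n%:R * delta) ->
  (forall x y, P x -> P y -> x < y -> x + delta <= y) ->
  exists s : seq R, forall x, P x -> x \in s.
Proof.
move=> delta0; elim: n a P => [|n IH] a P bound spaced.
  exists [::] => x /bound /andP[ax]; rewrite mul0r addr0 => /(le_lt_trans ax).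
  by rewrite ltxx.
have [x|x y [Px _] [Py _]|s hs] :=
  IH (a + delta) (fun x => P x /\ a + delta <= x).
- by move=> [/bound /andP[_ xn] ->] /=; move: xn; rewrite -natr1; lra.
- exact: spaced.
have [[x0 [Px0 x0a]]|nx] := pselect (exists x, P x /\ x < a + delta); last first.
  exists s => x Px; apply: hs; split=> //; rewrite leNgt; apply/negP => xa.
  by apply: nx; exists x.
exists (x0 :: s) => x Px; rewrite in_cons.
have [xa|xa] := ltP x (a + delta); last by rewrite hs ?orbT.
have /andP[ax _] := bound _ Px; have /andP[ax0 _] := bound _ Px0.
by case: (ltgtP x x0) => // [/(spaced _ _ Px Px0)|/(spaced _ _ Px0 Px)]; lra.
Qed.

(** * Records of the slope and their gaps *)

Section Records.
Variables (R : realType) (M : expansion R) (phi g : R -> R) (p q : R).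
Hypothesis pq : p < q.
Hypothesis phi_def : dset M (fun v => v 0%N = phi (v 1%N)).
Hypothesis phi_der : forall x, p <= x <= q -> is_derive x 1 phi (g x).
Hypothesis g_cvg : forall x, p <= x <= q -> {for x, continuous g}.
Hypothesis g_gt : forall x, p < x <= q -> g p < g x.
Hypothesis g_lt : forall x, p <= x < q -> g x < g q.
Hypothesis g_le1 : g q - g p <= 1.
Hypothesis g_wild : forall c d, p < c -> c < d -> d < q ->
  ~ strictly_increasing_on c d g.

Definition record (x : R) : Prop :=
  p < x < q /\ forall y, p <= y < x -> g y < g x.

Definition gap (x delta : R) : Prop :=
  [/\ record x, 0 < delta & forall y, x < y < x + delta -> ~ record y].

(** The gap at [z] is at least as long as the one at [x]: stages admit gaps in order of decreasing
    length. *)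
Definition gap_le (z x : R) : Prop := forall delta, gap x delta -> gap z delta.

Let gam := g q - g p.

Let gam0 : 0 < gam.
Proof. by rewrite subr_gt0 g_gt // pq lexx. Qed.

Lemma record_lt x y : record x -> record y -> (g x < g y) = (x < y).
Proof.
move=> [/andP[px _] hx] [/andP[py _] hy].
case: (ltgtP x y) => [xy|yx|->]; last by rewrite ltxx.
  by rewrite hy // xy ltW.
by apply/negbTE; rewrite -leNgt ltW // hx // yx ltW.
Qed.

Lemma record_inj x y : record x -> record y -> g x = g y -> x = y.
Proof.
move=> rx ry gxy; case: (ltgtP x y) => //.
  by rewrite -record_lt // gxy ltxx.
by rewrite -record_lt // gxy ltxx.
Qed.

Lemma record_value x : record x -> 0 < g x - g p < gam.
Proof.
move=> [/andP[px xq] _]; rewrite subr_gt0 g_gt ?px ?ltW //=.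
by rewrite ltrD2r g_lt // xq ltW.
Qed.

(** The first point at which [g - g p] takes the value [e] is a record. With [record_inj], records
    parametrize the value space bijectively. *)
Lemma record_of_value e : 0 < e < gam -> exists x, record x /\ g x - g p = e.
Proof.
move=> /andP[e0 eg].
have [||||x [/andP[px xq] gx hx]] := @first_hit R g p q (e + g p) => //.
- by rewrite ltrDr.
- by move: eg; rewrite /gam; lra.
exists x; split; last by rewrite gx; lra.
split; last by move=> y /hx; rewrite gx.
rewrite px lt_neqAle xq andbT; apply: contraTneq eg => xq'.
by rewrite -leNgt /gam -xq' gx; lra.
Qed.

Lemma gap_spaced x y delta : gap x delta -> gap y delta -> x < y -> x + delta <= y.
Proof.
move=> [_ _ fx] [ry _ _] xy; rewrite leNgt; apply/negP => yx.
by apply: (fx y) => //; rewrite xy.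
Qed.

Lemma gap_finite delta : 0 < delta ->
  exists s : seq R, forall x, gap x delta -> x \in s.
Proof.
move=> delta0; pose n := Num.bound ((q - p) / delta).
apply: (@spaced_finite R (gap^~ delta) p delta n) => //; last first.
  by move=> x y; apply: gap_spaced.
move=> x [[/andP[px xq] _] _ _]; rewrite ltW //=.
have : (q - p) / delta < n%:R.
  by apply: archi_boundP; apply: divr_ge0; rewrite ?subr_ge0 ltW.
by rewrite ltr_pdivrMr //; lra.
Qed.

Lemma gap_anti x delta delta' : 0 < delta' -> delta' <= delta ->
  gap x delta -> gap x delta'.
Proof.
move=> d0 dd [rx _ fx]; split=> // y /andP[xy yx]; apply: fx.
by rewrite xy /=; lra.
Qed.

(** By [gap_anti] the lengths available at a point form an initial segment of the positive reals,
    and two such segments are comparable. *)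
Lemma gap_le_total x y : gap_le x y \/ gap_le y x.
Proof.
have [|/existsNP[delta /not_implyP[gy ngx]]] := pselect (gap_le x y); first by left.
right=> delta' gx; apply: (gap_anti _ _ gy); first by case: gx.
rewrite leNgt; apply/negP => dd; apply: ngx; apply: gap_anti gx; last exact: ltW.
by case: gy.
Qed.

(* A maximum of [g] over [[p, z]] is first attained at a record [z1]; unless
   [z] is itself that record, [z1] starts a gap. *)
Lemma gap_dense u w : 0 <= u -> u < w -> w <= gam ->
  exists x delta, gap x delta /\ u < g x - g p < w.
Proof.
move=> u0 uw wg; apply: contrapT => nogap.
(* Values strictly inside [(u, w)], so that a gap starting at a value in [[v1, v2)] contradicts
   [nogap]. *)
pose v1 := u + (w - u) / 3; pose v2 := u + (w - u) * 2 / 3.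
have v1V : 0 < v1 < gam by rewrite /v1; apply/andP; split; lra.
have v2V : 0 < v2 < gam by rewrite /v2; apply/andP; split; lra.
have [c [rc gc]] := record_of_value v1V; have [d [rd gd]] := record_of_value v2V.
have cd : c < d by rewrite -record_lt //; move: gc gd; rewrite /v1 /v2; lra.
have [/andP[pc cq] hc] := rc; have [/andP[pd dq] hd] := rd.
(* In the absence of gaps every point between [c] and [d] is a record, so [g] would be strictly
   increasing there. *)
apply: (g_wild pc cd dq) => x y.
suff H z : c < z < d -> record z.
  rewrite !in_itv /= => /H [/andP[px _] _] /H [_ hy] xy.
  by apply: hy; rewrite xy ltW.
move=> /andP[cz zd].
have pz : p < z by apply: lt_trans cz.
have zq : z < q by apply: lt_trans dq.
have [||m] := @EVT_max R g p z; first exact: ltW.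
  apply: continuous_in_subspaceT => a; rewrite inE /= in_itv /= => /andP[pa az].
  by apply: g_cvg; rewrite pa (le_trans az) // ltW.
rewrite in_itv /= => /andP[pm mz] hm.
have cm : g c <= g m by apply: hm; rewrite in_itv /= !ltW.
have gpm : g p < g m by apply: lt_le_trans cm; apply: g_gt; rewrite pc ltW.
have pm' : p < m.
  by rewrite lt_neqAle pm andbT; apply: contraTneq gpm => ->; rewrite ltxx.
have [||||z1 [/andP[pz1 z1m] gz1 hz1]] := @first_hit R g p m (g m) => //.
  by move=> a /andP[pa am]; apply: g_cvg; rewrite pa (le_trans am) // ltW // (le_lt_trans mz).
have z1z : z1 <= z by apply: le_trans mz.
have rz1 : record z1.
  split; first by rewrite pz1 (le_lt_trans z1z).
  by move=> y' /hz1; rewrite gz1.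
case: (ltgtP z1 z) z1z => // [z1z|<- //] _.
exfalso; apply: nogap; exists z1, (z - z1); split.
  split=> //; first by rewrite subr_gt0.
  move=> y' /andP[y1 y2] [_ /(_ z1)].
  rewrite y1 ltW // => /(_ isT); rewrite gz1 ltNge hm // in_itv /=.
  by apply/andP; split; [rewrite ltW // (lt_trans pz1)|lra].
have gmd : g m < g d by apply: hd; rewrite pm (le_lt_trans mz).
by rewrite gz1; move: gc gd; rewrite /v1 /v2; lra.
Qed.

Lemma dset_record i : dset M (fun v => record (v i)).
Proof.
apply: (dset_app1 (P := record) _ (dfun_var M i)).
pose D (v : nat -> R) := p <= v 0%N <= q /\ p <= v 1%N <= q.
have dD : dset M D by rewrite /D; repeat dset_step.
have sD : slope_fun M D (fun v => g (v 1%N) - g (v 0%N)).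
  by apply: slopeB; apply: (slope_var phi_def phi_der) => v [].
have dlt := dset_slope_gt0 pq phi_def phi_der g_cvg g_gt dD sD.
have dR : dset M (fun v => p < v 0%N < q /\
    forall y, p <= y < v 0%N -> (p <= y <= q /\ p <= v 0%N <= q) /\ 0 < g (v 0%N) - g y).
  apply: dset_and; first by repeat dset_step.
  by apply: dset_all; apply: dset_imp; first by repeat dset_step.
apply: dset_iff dR => v; split=> -[/andP[px xq] H]; split; rewrite ?px //.
  by move=> y /H [_]; rewrite subr_gt0.
move=> y hy; have := H y hy; rewrite subr_gt0 => ->; move/andP: hy => [py yx].
by split=> //; split; rewrite ?py ltW // ?(lt_trans yx) // ltW.
Qed.

Lemma dset_gap i j : dset M (fun v => gap (v i) (v j)).
Proof.
apply: (dset_app2 (P := gap) _ (dfun_var M i) (dfun_var M j)).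
apply: dset_and3; [exact: dset_record|by repeat dset_step|].
apply: dset_all; apply: dset_imp; first by repeat dset_step.
by apply: dset_not; exact: dset_record.
Qed.

(** The values are the numbers [g x - g p] at records [x]; [E] consists of those whose record starts
    a gap, and [le] compares the gaps. *)
Lemma copy_PN_of_wild_slope : defines_copy_PN M.
Proof.
have [x0 [rx0 _]] : exists x, record x /\ g x - g p = gam / 2.
  by apply: record_of_value; move: gam0; lra.
(* A definable retraction onto the records, which makes [w] total; [x0] is an arbitrary record. *)
pose ret x := if `[< record x >] then x else x0.
have ret_record x : record (ret x) by rewrite /ret; case: asboolP.
have retK x : record x -> ret x = x by move=> rx; rewrite /ret asboolT.
have dret i : dfun M (fun v => ret (v i)).
  exact: (dfun_ite (dset_record i) (dfun_var M i) (dfun_const M x0)).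
pose w x := g (ret x) - g p.
have wV x : 0 < w x < gam by exact: record_value.
have /choice [xi xiP] : forall e, exists x, 0 < e < gam -> record x /\ g x - g p = e.
  move=> e; have [/record_of_value [x hx]|] := pselect (0 < e < gam); first by exists x.
  by exists 0.
have xi_record e : 0 < e < gam -> record (xi e) by move/xiP => [].
have xiK e : 0 < e < gam -> g (xi e) - g p = e by move/xiP => [].
have xiw x : xi (w x) = ret x.
  apply: record_inj => //; first exact: xi_record.
  by have := xiK _ (wV x); rewrite /w; lra.
have xig x : record x -> xi (g x - g p) = x.
  by move=> rx; rewrite -{1}(retK x rx) xiw retK.
pose E e := 0 < e < gam /\ exists delta, gap (xi e) delta.
pose le e e' := gap_le (xi e) (xi e').
have rI x : record x -> p <= x <= q by move=> [/andP[? ?] _]; rewrite !ltW.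
apply: (@copy_PN_of_values R M gam w E le gam0 g_le1 _ _ _ _ _ _ _ _ _ _ record).
- by move=> e [].
- move=> u v u0 uv vg; have [x [delta [gx xuv]]] := gap_dense u0 uv vg.
  have rx : record x by case: gx.
  exists (g x - g p) => //; split; first exact: record_value.
  by exists delta; rewrite xig.
- by move=> x y _ _; apply: gap_le_total.
- by move=> x y z xy yz delta /yz /xy.
- move=> e [eV [delta ge]]; have [_ d0 _] := ge.
  have [s hs] := gap_finite d0.
  exists [seq g x - g p | x <- s] => z [zV _] /(_ _ ge) /hs zs.
  by apply/mapP; exists (xi z) => //; rewrite xiK.
- by move=> e eV; exists (xi e); rewrite /w retK ?xiK //; apply: xi_record.
- apply: dset_iff (dset_lt (dret 0%N) (dret 1%N)) => v.
  by rewrite /w ltrD2r record_lt.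
- have dE : dset M (fun v => exists delta, gap (v 0%N) delta).
    by apply: dset_ex; exact: dset_gap.
  apply: dset_iff (dset_app1 (P := fun x => exists delta, gap x delta) dE (dret 0%N)).
  by move=> v; rewrite /E xiw; split=> [|[]].
- have dle : dset M (fun v => gap_le (v 0%N) (v 1%N)).
    by apply: dset_all; apply: dset_imp; exact: dset_gap.
  by apply: dset_iff (dset_app2 dle (dret 0%N) (dret 1%N)) => v; rewrite /le !xiw.
- pose D (v : nat -> R) := [/\ p <= v 0%N <= q, p <= v 1%N <= q, p <= v 2%N <= q
    & p <= v 3%N <= q].
  have dD : dset M D by rewrite /D; repeat dset_step.
  have sp : slope_fun M D (fun=> g p).
    by apply: (slope_const phi_def phi_der); rewrite lexx ltW.
  have sv i : (i < 4)%N -> slope_fun M D (fun v => g (v i) - g p).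
    move=> i4; apply: slopeB => //; apply: (slope_var phi_def phi_der) => v [].
    by case: i i4 => [|[|[|[|]]]].
  (* The ratio test is the sign of a polynomial in slopes. *)
  have sS : slope_fun M D (fun v => ((g (v 3%N) - g p) - (g (v 2%N) - g p)) -
     (g (v 0%N) - g p) * ((g (v 1%N) - g p) - (g (v 2%N) - g p))).
    by apply: slopeB; [apply: slopeB|apply: slopeM; [|apply: slopeB]]; exact: sv.
  have := dset_slope_ge0 pq phi_def phi_der g_cvg g_gt dD sS.
  move=> /(dset_app4 (P := fun a b c d => [/\ p <= a <= q, p <= b <= q, p <= c <= q
     & p <= d <= q] /\ 0 <= ((g d - g p) - (g c - g p)) -
     (g a - g p) * ((g b - g p) - (g c - g p)))).
  move=> /(_ _ _ _ _ (dret 0%N) (dret 1%N) (dret 2%N) (dret 3%N)).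
  apply: dset_iff => v; rewrite subr_ge0; split=> [[]//|h].
  by split=> //; split; exact: rI.
- exact: dset_record.
- by move=> e eV; exists (xi e); rewrite /w retK ?xiK //; [split=> //; apply: xi_record|apply: xi_record].
- by move=> x y rx ry; rewrite /w !retK // => /addIr; apply: record_inj.
Qed.

End Records.

(** * From the derivative to slope data *)

Lemma mean_value_on (R : realType) (a b : R) (h : R -> R) (x y : R) :
  (forall z, z \in `]a, b[ -> derivable h z 1) ->
  x \in `]a, b[ -> y \in `]a, b[ -> x < y ->
  exists c, [/\ x < c < y, c \in `]a, b[
    & h y - h x = derive1 h c * (y - x)].
Proof.
rewrite !in_itv /= => dh /andP[ax _] /andP[_ yb] xy.
have sub z : x <= z <= y -> z \in `]a, b[.
  by move=> /andP[xz zy]; rewrite in_itv /= (lt_le_trans ax xz) (le_lt_trans zy yb).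
have [||c] := @MVT R h (derive1 h) x y xy.
- move=> z; rewrite in_itv /= => /andP[xz zy]; rewrite derive1E.
  by apply/derivableP; apply: dh; apply: sub; rewrite !ltW.
- by apply: derivable_within_continuous => z; rewrite in_itv /= => /sub /dh.
rewrite in_itv /= => /andP[xc cy] hE; exists c; split=> //; first by rewrite xc.
by apply: sub; rewrite !ltW.
Qed.

(** If the derivative were constant, the mean value theorem based at the midpoint would make [h]
    affine. *)
Lemma nonconstant_slope (R : realType) (a b : R) (h : R -> R) :
  (forall z, z \in `]a, b[ -> derivable h z 1) -> ~ affine_on a b h ->
  exists u w, [/\ u \in `]a, b[, w \in `]a, b[, u < w
    & derive1 h u != derive1 h w].
Proof.
move=> dh naff; apply: contrapT => Hn; apply: naff.
have cst u w : u \in `]a, b[ -> w \in `]a, b[ -> derive1 h u = derive1 h w.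
  move=> uI wI; apply: contrapT => /eqP neq; apply: Hn.
  case: (ltgtP u w) => [uw|wu|uw]; first by exists u, w.
    by exists w, u; rewrite eq_sym.
  by move: neq; rewrite uw eqxx.
have [ab|ba] := ltP a b; last first.
  exists 0, 0 => x; rewrite in_itv /= => /andP[ax xb].
  by have := lt_le_trans (lt_trans ax xb) ba; rewrite ltxx.
pose m := (a + b) / 2.
have mI : m \in `]a, b[ by rewrite in_itv /= /m; apply/andP; split; lra.
exists (derive1 h m), (h m - derive1 h m * m) => x xI.
case: (ltgtP x m) => [xm|mx|->]; last by rewrite addrC subrK.
  have [c [_ cI hE]] := mean_value_on dh xI mI xm.
  by move: hE; rewrite (cst c m cI mI); lra.
have [c [_ cI hE]] := mean_value_on dh mI xI mx.
by move: hE; rewrite (cst c m cI mI); lra.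
Qed.

(** The derivative keeps its sign near [x] by continuity, and the mean value theorem applies. Meant
    for [h] the derivative of a [C2] function. *)
Lemma monotone_of_slope_neq0 (R : realType) (a b x : R) (h : R -> R) :
  C1_on a b h -> x \in `]a, b[ -> derive1 h x != 0 ->
  strictly_monotone_somewhere a b h.
Proof.
move=> [dh ch] xI nz.
have /andP[ax xb] : a < x < b by move: xI; rewrite in_itv.
have local eta : 0 < eta -> exists c d, [/\ c < d, `]c, d[ `<=` `]a, b[
    & forall y, y \in `]c, d[ -> `|y - x| < eta].
  move=> eta0; exists (Num.max a (x - eta)), (Num.min b (x + eta)); split.
  - by rewrite lt_min !gt_max; apply/andP; split; apply/andP; split; lra.
  - move=> y /=; rewrite !in_itv /= gt_max lt_min.
    by move=> /andP[/andP[-> _] /andP[-> _]].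
  - move=> y /=; rewrite !in_itv /= gt_max lt_min.
    move=> /andP[/andP[_ y1] /andP[_ y2]].
    by rewrite ltr_distl; apply/andP; split; lra.
have [neg|pos] : derive1 h x < 0 \/ 0 < derive1 h x.
- by case: (ltgtP (derive1 h x) 0) nz; tauto.
- have [eta eta0 H] := continuous_lt_near (ch x xI) neg.
  have [c [d [cd sub near_x]]] := local eta eta0.
  exists c, d; split=> //; right=> y z yI zI yz.
  have dh' t : t \in `]c, d[ -> derivable h t 1 by move=> /sub; apply: dh.
  have [t [_ tI hE]] := mean_value_on dh' yI zI yz.
  rewrite -subr_lt0 hE pmulr_llt0 ?subr_gt0 //.
  by apply: H; apply: near_x.
- have [eta eta0 H] := continuous_gt_near (ch x xI) pos.
  have [c [d [cd sub near_x]]] := local eta eta0.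
  exists c, d; split=> //; left=> y z yI zI yz.
  have dh' t : t \in `]c, d[ -> derivable h t 1 by move=> /sub; apply: dh.
  have [t [_ tI hE]] := mean_value_on dh' yI zI yz.
  rewrite -subr_gt0 hE pmulr_lgt0 ?subr_gt0 //.
  by apply: H; apply: near_x.
Qed.

(** The derivative is not constant, so by the mean value theorem the second derivative is nonzero
    somewhere. *)
Lemma monotone_slope_of_C2 (R : realType) (a b : R) (f : R -> R) :
  C2_on a b f -> ~ affine_on a b f ->
  strictly_monotone_somewhere a b (derive1 f).
Proof.
move=> [[df _] C1f'] naff.
have [u [w [uI wI uw neq]]] := nonconstant_slope df naff.
have [c [_ cI hE]] := mean_value_on C1f'.1 uI wI uw.
apply: (monotone_of_slope_neq0 C1f' cI); apply/eqP => f''0.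
by move: hE neq; rewrite f''0 mul0r => /eqP; rewrite subr_eq0 eq_sym => ->.
Qed.

(** * Normalization of the given function, and the two alternatives *)

Section Setup.
Variables (R : realType) (M : expansion R).

(* The normal form of the data: a total definable function whose derivative [g]
   on [[p, q]] takes its minimum only at [p] and its maximum only at [q]. *)
Definition slope_data (phi g : R -> R) (p q : R) : Prop :=
  [/\ p < q, dset M (fun v => v 0%N = phi (v 1%N)),
      forall x, p <= x <= q -> is_derive x 1 phi (g x),
      forall x, p <= x <= q -> {for x, continuous g}
    & [/\ forall x, p < x <= q -> g p < g x, forall x, p <= x < q -> g x < g q
        & g q - g p <= 1]].

(** [q] is the first point after [u] where [g] reaches [B], and [p] the last point before [q] where
    [g] equals [g u]. Capping [B] at [g u + 1] bounds the value space by 1. *)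
Lemma slope_data_of_increase (phi g : R -> R) (u w : R) : u < w ->
  dset M (fun v => v 0%N = phi (v 1%N)) ->
  (forall x, u <= x <= w -> is_derive x 1 phi (g x)) ->
  (forall x, u <= x <= w -> {for x, continuous g}) ->
  g u < g w -> exists p q, [/\ u <= p, q <= w & slope_data phi g p q].
Proof.
move=> uw dphi dg cg guw; pose B := Num.min (g w) (g u + 1).
have guB : g u < B by rewrite lt_min guw ltrDl ltr01.
have Bgw : B <= g w by rewrite ge_min lexx.
have B1 : B <= g u + 1 by rewrite ge_min lexx orbT.
have [q [/andP[uq qw] gq hq]] := first_hit uw cg guB Bgw.
have cg' x : u <= x <= q -> {for x, continuous g}.
  by move=> /andP[ux xq]; apply: cg; rewrite ux (le_trans xq).
have [||p [/andP[up pq] gp hp]] := last_hit uq cg' (B := g u) => //.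
  by rewrite gq.
have sub x : p <= x <= q -> u <= x <= w.
  by move=> /andP[px xq]; rewrite (le_trans up px) (le_trans xq qw).
exists p, q; split=> //; split=> //.
- by move=> x /sub; apply: dg.
- by move=> x /sub; apply: cg.
split.
- by move=> x /hp; rewrite gp.
- by move=> x /andP[px xq]; rewrite gq hq // xq (le_trans up).
- by rewrite gq gp; lra.
Qed.

Variables (a b : R) (f : R -> R).
Hypothesis f_def : definable_fun1 M `]a, b[ f.
Hypothesis f_C1 : C1_on a b f.

(** Up to replacing [f] by its opposite, the derivative is larger at [w] than at [u]. *)
Lemma slope_data_exists u w : u \in `]a, b[ -> w \in `]a, b[ -> u < w ->
  derive1 f u != derive1 f w -> exists phi g p q,
  [/\ u <= p, q <= w, slope_data phi g p q
    & g = derive1 f \/ g = (fun x => - derive1 f x)].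
Proof.
rewrite !in_itv /= => /andP[au ub] /andP[aw wb] uw neq.
(* Extension by 0 gives a total definable function; it agrees with [f] near each point of [[u, w]],
   so the derivative there is unchanged. *)
pose phi x := if `[< a < x < b >] then f x else 0.
have dgraph : dset M (fun v => a < v 1%N < b /\ v 0%N = f (v 1%N)).
  have := f_def; rewrite /definable_fun1 => /definable_dset.
  move=> /(dset_rename (fun k => if k is 0 then 1 else 0)%N).
  apply: dset_iff => v; set t := (X in _ X <-> _).
  have -> : t = [tuple v 1%N; v 0%N].
    by apply: eq_from_tnth => -[[|[|i]] hi] //; rewrite tnth_mktuple.
  rewrite /= ; split=> [[x xI /(congr1 val) /= [<- <-]]|[vI ->]].
    by move: xI; rewrite /= in_itv.
  by exists (v 1%N); rewrite //= in_itv.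
have dphi : dfun M (fun v => phi (v 0%N)).
  have dI : dset M (fun v => a < v 1%N < b) by repeat dset_step.
  have d0 : dset M (fun v => v 0%N = 0) by repeat dset_step.
  apply: dset_iff (dset_or dgraph (dset_and (dset_not dI) d0)) => v.
  by rewrite /phi; case: asboolP; tauto.
have sub x : u <= x <= w -> x \in `]a, b[.
  by move=> /andP[ux xw]; rewrite in_itv /= (lt_le_trans au ux) (le_lt_trans xw wb).
have phi_der x : u <= x <= w -> is_derive x 1 phi (derive1 f x).
  move=> /sub xI; have df : is_derive x 1 f (derive1 f x).
    by rewrite derive1E; apply/derivableP; apply: f_C1.1.
  apply: near_eq_is_derive df.
  have : \forall y \near x, y \in `]a, b[ by exact: near_in_itvoo.
  by apply: filterS => y; rewrite in_itv /= /phi => yI; rewrite asboolT.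
have f_cvg x : u <= x <= w -> {for x, continuous (derive1 f)}.
  by move=> /sub; apply: f_C1.2.
case: (ltgtP (derive1 f u) (derive1 f w)) neq => // [inc|dec] _.
  have [p [q [up qw H]]] := slope_data_of_increase uw dphi phi_der f_cvg inc.
  by exists phi, (derive1 f), p, q; split=> //; left.
have dec' : - derive1 f u < - derive1 f w by rewrite ltrN2.
have [|x xI|x xI|p [q [up qw H]]] :=
  @slope_data_of_increase (fun x => - phi x) (fun x => - derive1 f x) u w uw _ _ _ dec'.
- exact: (dfun_opp dphi).
- by apply: is_deriveN; apply: phi_der.
- by apply: (cvgN (f := derive1 f)); apply: f_cvg.
by exists (fun x => - phi x), (fun x => - derive1 f x), p, q; split=> //; right.
Qed.

Lemma field_type_of_monotone_slope :
  strictly_monotone_somewhere a b (derive1 f) -> field_type M.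
Proof.
move=> [c [d [cd cdab mono]]].
(* Interior points, so that the closed interval [[p, q]] stays inside [(c, d)]. *)
pose u := c + (d - c) / 3; pose w := c + (d - c) * 2 / 3.
have uI : u \in `]c, d[ by rewrite in_itv /= /u; apply/andP; split; lra.
have wI : w \in `]c, d[ by rewrite in_itv /= /w; apply/andP; split; lra.
have uw : u < w by rewrite /u /w; lra.
have neq : derive1 f u != derive1 f w.
  case: mono => [inc|dec]; first by rewrite lt_eqF // inc.
  by rewrite gt_eqF // dec.
have [phi [g [p [q [up qw [pq dphi phi_der g_cvg [g_gt _ _]] gE]]]]] :=
  slope_data_exists (cdab _ uI) (cdab _ wI) uw neq.
have sub x : p <= x <= q -> x \in `]c, d[.
  move: uI wI; rewrite !in_itv /= => /andP[cu _] /andP[_ wd] /andP[px xq].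
  by rewrite (lt_le_trans cu (le_trans up px)) (le_lt_trans (le_trans xq qw) wd).
apply: (field_type_of_increasing_slope pq dphi phi_der g_cvg) => x y px xy yq.
have xI : x \in `]c, d[ by apply: sub; rewrite px ltW // (lt_le_trans xy).
have yI : y \in `]c, d[ by apply: sub; rewrite yq ltW // (le_lt_trans px).
have pI : p \in `]c, d[ by apply: sub; rewrite lexx ltW.
have qI : q \in `]c, d[ by apply: sub; rewrite lexx ltW.
have : g p < g q by apply: g_gt; rewrite pq lexx.
(* [g p < g q] excludes the two combinations of sign and direction under which [g] would
   decrease. *)
case: mono => mono; case: gE => ->; rewrite ?ltrN2 => gpq.
- exact: mono.
- by have := lt_trans gpq (mono _ _ pI qI pq); rewrite ltxx.
- by have := lt_trans gpq (mono _ _ pI qI pq); rewrite ltxx.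
- exact: mono.
Qed.

(** An interval where [g] increases would be one where the derivative of [f] is strictly monotone,
    in the direction given by the sign in [g]. *)
Lemma copy_PN_of_nonmonotone_slope : ~ affine_on a b f ->
  ~ strictly_monotone_somewhere a b (derive1 f) -> defines_copy_PN M.
Proof.
move=> naff nmono.
have [u [w [uI wI uw neq]]] := nonconstant_slope f_C1.1 naff.
have [phi [g [p [q [up qw [pq dphi phi_der g_cvg [g_gt g_lt g1]] gE]]]]] :=
  slope_data_exists uI wI uw neq.
apply: (copy_PN_of_wild_slope pq dphi phi_der g_cvg g_gt g_lt g1).
move=> c d pc cd dq inc; apply: nmono; exists c, d; split=> //.
  move: uI wI => /=; rewrite !in_itv /= => /andP[au _] /andP[_ wb] x /=.
  rewrite !in_itv /= => /andP[cx xd].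
  by apply/andP; split; lra.
case: gE inc => ->; first by left.
by move=> inc; right=> x y xI yI xy; rewrite -ltrN2; apply: inc.
Qed.

End Setup.

Unset Implicit Arguments.

Theorem theorem2p1 (R : realType) (M : expansion R) (a b : R) (f : R -> R)
    (ltab : a < b)
    (f_def : definable_fun1 M `]a, b[ f)
    (f_C1 : C1_on a b f)
    (f_nonaffine : ~ affine_on a b f) :
  [/\ strictly_monotone_somewhere a b (derive1 f) -> field_type M,
      ~ strictly_monotone_somewhere a b (derive1 f) -> defines_copy_PN M
    & C2_on a b f -> field_type M].
Proof.
split.
- exact: field_type_of_monotone_slope f_def f_C1.
- exact: copy_PN_of_nonmonotone_slope f_def f_C1 f_nonaffine.
- move=> /monotone_slope_of_C2 /(_ f_nonaffine).
  exact: field_type_of_monotone_slope f_def f_C1.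
Qed.
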